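(* There is a function $g:\mathbb{Z}_{\ge 1}\to\mathbb{R}_{\ge 0}$ with $g(t)/t\to 0$ as $t\to\infty$ such that the following hold. (1) Let $H$ be a connected graph on $t\geq 1$ vertices and let $x=x(H)$ be the number of edges of a largest matching in the complement of $H$. For every positive integer $n$, every graph on $n$ vertices with no $H$-minor has at most $$\max\left(3^{2t/3-x/3+g(t)}\,n,\ 2^{t+g(t)}\,n\right)$$ cliques. (2) (Tightness) For all sufficiently large $t$, every connected graph $H$ on $t$ vertices with $x=x(H)$, and every integer $n\ge \max(4t/3-2x/3,\ t)$, there is a graph on $n$ vertices with no $H$-minor that has at least $$\max\left(3^{2t/3-x/3-g(t)}\,n,\ 2^{t-g(t)}\,n\right)$$ cliques.
   Context: All graphs are finite and simple. A clique of a graph is a set of pairwise adjacent vertices; the empty set and single vertices count as cliques (so the complete graph on $n$ vertices has $2^n$ cliques). A graph $H$ is a minor of a graph $G$ if $H$ can be obtained (up to isomorphism) from $G$ by contracting edges and deleting vertices and edges. The function $g$ makes explicit the error term $o(t)$, which depends only on $t$. *)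

(* Defs.v *)
From mathcomp Require Import all_boot.

Set Implicit Arguments.
Unset Strict Implicit.
Unset Printing Implicit Defensive.

Record sgraph := SGraph {
  vertex :> finType;
  adj : rel vertex;
  adj_sym : symmetric adj;
  adj_irrefl : irreflexive adj }.

Definition connected_graph (G : sgraph) : Prop :=
  0 < #|G| /\ forall u v : G, connect (@adj G) u v.

Definition compl_adj (G : sgraph) : rel G := fun u v => (u != v) && ~~ adj u v.

Lemma compl_adj_sym (G : sgraph) : symmetric (@compl_adj G).
Proof. by move=> u v; rewrite /compl_adj eq_sym adj_sym. Qed.

Lemma compl_adj_irrefl (G : sgraph) : irreflexive (@compl_adj G).
Proof. by move=> u; rewrite /compl_adj eqxx. Qed.

Definition compl_graph (G : sgraph) : sgraph :=
  SGraph (@compl_adj_sym G) (@compl_adj_irrefl G).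

Definition edges (G : sgraph) : {set {set G}} :=
  [set e : {set G} | [exists u, exists v, adj u v && (e == [set u; v])]].

Definition matching (G : sgraph) (M : {set {set G}}) : bool :=
  (M \subset edges G) && trivIset M.

Definition matching_number (G : sgraph) : nat :=
  \max_(M : {set {set G}} | matching M) #|M|.

Definition is_clique (G : sgraph) (K : {set G}) : bool :=
  [forall u in K, forall v in K, (u != v) ==> adj u v].

Definition num_cliques (G : sgraph) : nat :=
  #|[set K : {set G} | is_clique K]|.

Definition graph_iso (H G : sgraph) : Prop :=
  exists2 f : H -> G, bijective f & forall u v, adj (f u) (f v) = adj u v.

Section Operations.
Variable G : sgraph.

Definition del_vertex_adj (w : G) : rel {x : G | x != w} :=
  fun x y => adj (val x) (val y).

Lemma del_vertex_sym w : symmetric (del_vertex_adj (w := w)).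
Proof. by move=> x y; apply: adj_sym. Qed.

Lemma del_vertex_irrefl w : irreflexive (del_vertex_adj (w := w)).
Proof. by move=> x; apply: adj_irrefl. Qed.

Definition del_vertex (w : G) : sgraph :=
  SGraph (@del_vertex_sym w) (@del_vertex_irrefl w).

Definition del_edge_adj (u v : G) : rel G :=
  fun x y => adj x y && ([set x; y] != [set u; v]).

Lemma del_edge_sym u v : symmetric (del_edge_adj u v).
Proof. by move=> x y; rewrite /del_edge_adj adj_sym setUC. Qed.

Lemma del_edge_irrefl u v : irreflexive (del_edge_adj u v).
Proof. by move=> x; rewrite /del_edge_adj adj_irrefl. Qed.

Definition del_edge (u v : G) : sgraph :=
  SGraph (@del_edge_sym u v) (@del_edge_irrefl u v).

(* Contracting the edge uv: v is removed and u plays the role of the merged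
   vertex, so u inherits the neighbours of v; loops and parallel edges are
   suppressed. *)
Definition contract_adj (u v : G) : rel {x : G | x != v} := fun x y =>
  (x != y) &&
  [|| adj (val x) (val y),
      (val x == u) && adj v (val y)
    | (val y == u) && adj v (val x)].

Lemma contract_sym u v : symmetric (contract_adj u (v := v)).
Proof.
move=> x y; rewrite /contract_adj eq_sym (adj_sym (val x)).
by congr (_ && (_ || _)); rewrite orbC.
Qed.

Lemma contract_irrefl u v : irreflexive (contract_adj u (v := v)).
Proof. by move=> x; rewrite /contract_adj eqxx. Qed.

Definition contract (u v : G) : sgraph :=
  SGraph (@contract_sym u v) (@contract_irrefl u v).

End Operations.

Inductive minor (H : sgraph) : sgraph -> Prop :=
| minor_iso (G : sgraph) : graph_iso H G -> minor H G
| minor_del_vertex (G : sgraph) (w : G) : minor H (del_vertex w) -> minor H G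
| minor_del_edge (G : sgraph) (u v : G) : adj u v -> minor H (del_edge u v) -> minor H G
| minor_contract (G : sgraph) (u v : G) : adj u v -> minor H (contract u v) -> minor H G.

(* Main.v *)
(* Upper bound.  Mader's contraction argument makes a graph G without H-minor
   O(t log t)-degenerate, so up to a factor n it suffices to count the cliques
   inside sets of O(t log t) vertices.  Branching on a vertex with more than D
   non-neighbours (D a power of log t) costs only a factor 2^o(t), and leaves a
   set A of m vertices in which every vertex has at most D non-neighbours.
   A symmetrisation argument in the style of Zykov finds in A an induced
   complement of a matching, with r matched pairs and q further vertices, such
   that A has at most 2^(m/2) (3/2)^r 2^(q/2) cliques.  All but D^2 of the other
   vertices of A can be grouped into pairs that dominate A; together with the
   2r + q single vertices these pairs are the branch sets of a minor which is
   complete up to r missing edges, and this must not contain H.  Optimising over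
   r and q gives the two exponential bounds.
   Lower bound.  Disjoint copies of the complete graph on t - 1 vertices, or of
   the complement of a perfect matching on about 4t/3 - 2x/3 vertices. *)

Require Import Defs.
From mathcomp Require Import all_boot zify.
Set Implicit Arguments.
Unset Strict Implicit.
Unset Printing Implicit Defensive.

(** * Minors and branch sets *)

(** Connectivity stated through cuts: every nonempty proper part of [S] sends an edge to the rest.
    Cuts are easily pulled back along maps, so no paths or induced subgraphs are needed. *)
Definition conn (G : sgraph) (S : {set G}) : Prop :=
  S != set0 /\
  forall P : {set G}, P \subset S -> P != set0 -> P != S ->
    exists x y, [/\ x \in P, y \in S :\: P & adj x y].

Definition touch (G : sgraph) (S T : {set G}) : Prop :=
  exists x y, [/\ x \in S, y \in T & adj x y].

(** The branch-set description of a minor; [minor_model] and [model_minor] show that it agrees with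
    the inductive [minor]. *)
Definition model (H G : sgraph) : Prop :=
  exists phi : H -> {set G},
    [/\ forall h, conn (phi h),
        forall h h', h != h' -> [disjoint phi h & phi h']
      & forall h h', adj h h' -> touch (phi h) (phi h')].

Lemma conn1 (G : sgraph) (x : G) : conn [set x].
Proof.
split=> [|P PS P0 PnS]; first by apply/set0Pn; exists x; rewrite inE.
by move: PS; rewrite subset1 (negPf P0) (negPf PnS).
Qed.

Lemma conn_add (G : sgraph) (S : {set G}) (x y : G) :
  conn S -> y \in S -> adj x y -> conn (x |: S).
Proof.
move=> [S0 cS] yS xy; split; first by apply/set0Pn; exists x; rewrite setU11.
move=> P PS P0 PnS.
have [xS|xS] := boolP (x \in S).
  have E : x |: S = S by apply/setUidPr; rewrite sub1set.
  by move: PS PnS; rewrite E => PS PnS; apply: cS.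
have [xP|xP] := boolP (x \in P); last first.
  have PS' : P \subset S.
    apply/subsetP=> z zP; have := subsetP PS z zP.
    by rewrite !inE => /orP[/eqP zx|//]; rewrite -zx zP in xP.
  have [PE|PE] := eqVneq P S.
    by exists y, x; rewrite PE yS !inE xS eqxx adj_sym.
  have [a [b [aP bP ab]]] := cS P PS' P0 PE; exists a, b; split=> //.
  by move: bP; rewrite !inE => /andP[-> ->]; rewrite orbT.
(* Now [x] is in [P]. Either [P] misses [S] and the edge [xy] leaves [P], or [P :&: S] is a proper
   cut of [S]. *)
have [PS0|PS0] := eqVneq (P :&: S) set0.
  exists x, y; split=> //; rewrite !inE yS orbT andbT.
  by apply/negP=> yP; have : y \in P :&: S by [rewrite inE yP yS];
     rewrite PS0 inE.
have PnS' : P :&: S != S.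
  apply/eqP=> E; move/eqP: PnS; apply; apply/eqP; rewrite eqEsubset PS /=.
  by rewrite subUset sub1set xP /= -E subsetIl.
have [a [b [aP bP ab]]] := cS _ (subsetIr P S) PS0 PnS'.
exists a, b; move: aP bP; rewrite !inE => /andP[-> _] /andP[nb bS].
by rewrite bS orbT andbT; move: nb; rewrite bS andbT.
Qed.

Lemma conn2 (G : sgraph) (x y : G) : adj x y -> conn [set x; y].
Proof. by move=> xy; apply: (conn_add (conn1 y)) xy; rewrite inE. Qed.

Lemma conn_edge (G : sgraph) (S : {set G}) :
  conn S -> 1 < #|S| -> exists u v, [/\ u \in S, v \in S & adj u v].
Proof.
move=> [/set0Pn[x xS] cS] S1.
have [a [b [aP bP ab]]] : exists a b, [/\ a \in [set x], b \in S :\ x & adj a b].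
  apply: cS; rewrite ?sub1set //; first by apply/set0Pn; exists x; rewrite inE.
  by apply/eqP=> E; rewrite -E cards1 in S1.
by exists a, b; move: aP bP ab; rewrite !inE => /eqP-> /andP[_ ->].
Qed.

Lemma conn_imset (G G' : sgraph) (f : G' -> G) (S : {set G'}) :
  {homo f : x y / adj x y} -> conn S -> conn (f @: S).
Proof.
move=> fh [/set0Pn[x xS] cS]; split.
  by apply/set0Pn; exists (f x); apply: imset_f.
move=> P PS P0 PnS.
have [||y [z [yP zP yz]]] := cS (S :&: f @^-1: P) (subsetIl _ _).
- case/set0Pn: P0 => p pP; case/imsetP: (subsetP PS p pP) => y yS E.
  by apply/set0Pn; exists y; rewrite !inE yS -E.
- apply/eqP=> E; case/eqP: PnS; apply/eqP; rewrite eqEsubset PS.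
  apply/subsetP=> _ /imsetP[y yS ->]; move: yS; rewrite -E.
  by rewrite !inE => /andP[].
move: yP zP; rewrite !inE => /andP[yS yP] /andP[nz zS].
exists (f y), (f z); rewrite yP fh // inE imset_f // andbT.
by move: nz; rewrite zS.
Qed.

Lemma model_lift (H G G' : sgraph) (f : G' -> G) :
  injective f -> {homo f : x y / adj x y} -> model H G' -> model H G.
Proof.
move=> fI fh [phi [c d t]]; exists (fun h => f @: phi h); split=> [h|h h' /d|h h' /t].
- exact: conn_imset.
- move=> D; rewrite disjoint_subset; apply/subsetP=> _ /imsetP[x xS ->].
  rewrite inE; apply/imsetP=> -[y yS /fI E].
  by have := disjointFr D xS; rewrite E yS.
- by case=> x [y [xS yS xy]]; exists (f x), (f y); rewrite !imset_f ?fh.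
Qed.

Section Contract.
Variables (G : sgraph) (u v : G).
Hypothesis uv : adj u v.
Local Notation CG := (contract u v).

Lemma edge_neq : u != v.
Proof. by apply: contraTneq uv => ->; rewrite adj_irrefl. Qed.

(** The quotient map of the contraction: the default value of [insubd] is [u], so [v] goes to [u]
    and every other vertex to itself. *)
Definition rep (x : G) : CG := insubd (exist _ u edge_neq : CG) x.

Lemma val_rep x : val (rep x) = if x == v then u else x.
Proof. by rewrite val_insubd /=; case: eqP. Qed.

Definition contract_lift (S : {set CG}) : {set G} := rep @^-1: S.

Lemma rep_val (x : CG) : rep (val x) = x.
Proof. by apply: val_inj; rewrite val_rep (negPf (valP x)). Qed.

Lemma rep_v : rep v = rep u.
Proof. by apply: val_inj; rewrite !val_rep eqxx (negPf edge_neq). Qed.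

Lemma adj_rep (x y : G) : rep x != rep y -> adj x y -> adj (rep x) (rep y).
Proof.
move=> nxy xy; rewrite /= /contract_adj nxy /= !val_rep.
have [xv|xv] := eqVneq x v; have [yv|yv] := eqVneq y v.
- by rewrite xv yv adj_irrefl in xy.
- by move: xy; rewrite xv eqxx => ->; rewrite orbT.
- by move: xy; rewrite yv eqxx adj_sym => ->; rewrite !orbT.
- by rewrite xy.
Qed.

Lemma adj_unrep (x y : CG) : adj x y ->
  exists a b, [/\ adj a b, rep a = x & rep b = y].
Proof.
case/andP=> nxy /or3P[xy|/andP[/eqP xu vy]|/andP[/eqP yu vx]].
- by exists (val x), (val y); rewrite !rep_val.
- by exists v, (val y); rewrite !rep_val rep_v -xu rep_val.
- by exists (val x), v; rewrite !rep_val rep_v -yu rep_val adj_sym.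
Qed.

(** A cut of the preimage either separates [u] from [v], and then the edge [uv] crosses it, or is a
    union of fibres of [rep] and so comes from a cut of [S]. *)
Lemma conn_contract_lift (S : {set CG}) : conn S -> conn (contract_lift S).
Proof.
move=> [/set0Pn[x xS] cS]; split.
  by apply/set0Pn; exists (val x); rewrite inE rep_val.
move=> P PS P0 PnS.
have [uvP|] := boolP ((u \in P) == (v \in P)); last first.
  have LS : rep v \in S -> (u \in contract_lift S) && (v \in contract_lift S).
    by rewrite !inE -rep_v => ->.
  have [uP|uP] := boolP (u \in P) => vP.
    exists u, v; rewrite uP uv inE; split=> //; rewrite vP.
    by have /LS/andP[] // : rep v \in S by move/(subsetP PS): uP; rewrite inE rep_v.
  have {}vP : v \in P by case: (v \in P) vP.
  exists v, u; rewrite vP adj_sym uv inE uP; split=> //.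
  by have /LS/andP[] // : rep v \in S by move/(subsetP PS): vP; rewrite inE.
have repP z : z \in P = (val (rep z) \in P).
  by rewrite val_rep; case: eqP => // ->; rewrite (eqP uvP).
have [|||a [b [aP bP ab]]] := cS (S :&: val @^-1: P).
- exact: subsetIl.
- case/set0Pn: P0 => p pP; apply/set0Pn; exists (rep p).
  by rewrite !inE -repP pP andbT; move/(subsetP PS): pP; rewrite inE.
- apply/eqP=> E; case/eqP: PnS; apply/eqP; rewrite eqEsubset PS.
  by apply/subsetP=> z; rewrite inE -E !inE -repP => /andP[].
have [a' [b' [ab' Ea Eb]]] := adj_unrep ab.
exists a', b'; rewrite ab' !inE (repP a') (repP b') Ea Eb.
by move: aP bP; rewrite !inE => /andP[_ ->] /andP[nb bS];
  rewrite bS /= in nb *; split=> //; rewrite nb.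
Qed.

Lemma model_contract (H : sgraph) : model H CG -> model H G.
Proof.
move=> [phi [c d t]]; exists (fun h => contract_lift (phi h)); split=> [h|h h' /d|h h' /t].
- exact: conn_contract_lift.
- move=> D; rewrite disjoint_subset; apply/subsetP=> x.
  by rewrite !inE => xS; rewrite (disjointFr D xS).
- case=> x [y [xS yS /adj_unrep[a [b [ab Ea Eb]]]]].
  by exists a, b; rewrite !inE Ea Eb.
Qed.

(** The first hypothesis makes the trace of [S] on the surviving vertices equal to the image of [S]
    under [rep]. *)
Lemma conn_contract_pull (S : {set G}) : (v \in S -> u \in S) ->
  conn S -> conn ([set x | val x \in S] : {set CG}).
Proof.
move=> vuS [/set0Pn[x xS] cS]; have repS z : z \in S -> val (rep z) \in S.
  by rewrite val_rep; case: eqP => // ->.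
split; first by apply/set0Pn; exists (rep x); rewrite inE repS.
move=> P PS P0 PnS.
have [|||a [b [aP bP ab]]] := cS (S :&: contract_lift P).
- exact: subsetIl.
- case/set0Pn: P0 => p pP; apply/set0Pn; exists (val p).
  by rewrite !inE rep_val pP andbT; have := subsetP PS p pP; rewrite inE.
- apply/eqP=> E; case/eqP: PnS; apply/eqP; rewrite eqEsubset PS.
  by apply/subsetP=> z; rewrite inE -E !inE rep_val => /andP[].
move: aP bP; rewrite !inE => /andP[aS aP] /andP[+ bS]; rewrite bS /= => nb.
exists (rep a), (rep b); rewrite aP !inE nb repS //; split=> //.
by apply: adj_rep => //; apply: contraNneq nb => <-.
Qed.
End Contract.

Lemma minor_model (H G : sgraph) : minor H G -> model H G.
Proof.
elim=> {G} [G [f [g fK gK] fa]|G w _|G u v uv _|G u v uv _].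
- exists (fun h => [set f h]); split=> [h|h h' hh|h h' hh].
  + exact: conn1.
  + by rewrite disjoints1 inE (can_eq fK).
  + by exists (f h), (f h'); rewrite !inE fa.
- by apply: (@model_lift _ _ (del_vertex w) (fun x => val x)) => //; exact: val_inj.
- by apply: (@model_lift H G (del_edge u v) id) => // x y /andP[].
- exact: model_contract.
Qed.

Lemma card_neq_sig (T : finType) (w : T) : #|{: {x : T | x != w}}| = #|T|.-1.
Proof. by rewrite card_sig -(cardC1 w); apply: eq_card => x; rewrite !inE. Qed.

(** Edges of [G] that do not come from [H] are deleted one by one, by induction on the number of
    adjacent ordered pairs, until [f] is an isomorphism. *)
Lemma bij_minor (H G : sgraph) (f : H -> G) :
  bijective f -> {homo f : x y / adj x y} -> minor H G.
Proof.
have [n] := ubnP #|[set p : G * G | adj p.1 p.2]|.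
elim: n => // n IHn in G f * => leE bf fh; have [g fK gK] := bf.
have [/forallP iso|] := boolP [forall h, forall h', adj (f h) (f h') ==> adj h h'].
  apply: minor_iso; exists f => // h h'; apply/idP/idP; last exact: fh.
  exact/implyP/(forallP (iso h)).
rewrite negb_forall => /existsP[a]; rewrite negb_forall => /existsP[b].
rewrite negb_imply => /andP[fab nab].
apply: (minor_del_edge fab); apply: (IHn (del_edge (f a) (f b)) f) => //.
  rewrite -ltnS; apply: leq_trans leE; rewrite ltnS; apply: proper_card.
  apply/properP; split; first by apply/subsetP=> p; rewrite !inE => /andP[].
  by exists (f a, f b); rewrite inE //= /del_edge_adj eqxx andbF.
move=> x y xy; rewrite /= /del_edge_adj fh //=; apply/eqP=> E.
have : f x \in [set f a; f b] by rewrite -E !inE eqxx.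
have : f y \in [set f a; f b] by rewrite -E !inE eqxx orbT.
rewrite !inE !(can_eq fK) => /orP[]/eqP ey /orP[]/eqP ex; move: xy nab.
- by rewrite ex ey adj_irrefl.
- by rewrite ex ey adj_sym => ->.
- by rewrite ex ey => ->.
- by rewrite ex ey adj_irrefl.
Qed.

Lemma conn_del_pull (G : sgraph) (w : G) (S : {set G}) : w \notin S ->
  conn S -> conn ([set x | val x \in S] : {set del_vertex w}).
Proof.
move=> wS [/set0Pn[x xS] cS].
have wN z : z \in S -> z != w by apply: contraTneq => ->.
split; first by apply/set0Pn; exists (exist _ x (wN _ xS)); rewrite inE.
move=> P PS P0 PnS.
have [|||a [b [aP bP ab]]] := cS [set val y | y in P].
- by apply/subsetP=> _ /imsetP[y /(subsetP PS) yP ->]; rewrite inE in yP.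
- case/set0Pn: P0 => p pP; apply/set0Pn; exists (val p); exact: imset_f.
- apply/eqP=> E; case/eqP: PnS; apply/eqP; rewrite eqEsubset PS.
  by apply/subsetP=> z; rewrite inE -E mem_imset //; exact: val_inj.
case/imsetP: aP ab => y yP -> yb; move: bP; rewrite inE => /andP[nb bS].
exists y, (exist _ b (wN _ bS)); rewrite yP !inE /= bS andbT; split=> //.
by apply: contraNN nb => bP; apply/imsetP; exists (exist _ b (wN _ bS)).
Qed.

(** Induction on the number of vertices of [G]: contract an edge inside a branch set that has two
    vertices, else delete a vertex lying in no branch set. When neither exists, the branch sets are
    singletons covering [G], and [bij_minor] applies. *)
Lemma model_minor (H G : sgraph) : model H G -> minor H G.
Proof.
have [n] := ubnP #|G|; elim: n => // n IHn in G * => leG [phi [c d t]].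
have [/existsP[h h1]|] := boolP [exists h, 1 < #|phi h|].
  have [u [v [uS vS uv]]] := conn_edge (c h) h1.
  apply: (minor_contract uv); apply: IHn.
    by rewrite card_neq_sig -ltnS prednK //; apply/card_gt0P; exists u.
  have vu h' : v \in phi h' -> u \in phi h'.
    by have [<- _ //|/d/disjointFr/(_ vS) ->] := eqVneq h h'.
  exists (fun h => [set x | val x \in phi h]); split=> [h'|h1' h2 /d|h1' h2 /[dup] h12 /t].
  - exact: (conn_contract_pull uv (vu h') (c h')).
  - move=> D; rewrite disjoint_subset; apply/subsetP=> x.
    by rewrite !inE => /(disjointFr D) ->.
  - case=> x [y [xS yS xy]]; exists (rep uv x), (rep uv y).
    have repS z h' : z \in phi h' -> val (rep uv z) \in phi h'.
      by rewrite val_rep; case: eqP => // -> /vu.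
    rewrite !inE !repS //; split=> //; apply: adj_rep xy.
    apply/eqP=> E; have h12n : h1' != h2 by apply: contraTneq h12 => ->; rewrite adj_irrefl.
    have := disjointFr (d _ _ h12n) (repS _ _ xS); by rewrite E repS.
rewrite negb_exists => /forallP h1.
have [/existsP[w /forallP wn]|] := boolP [exists w, forall h, w \notin phi h].
  apply: (@minor_del_vertex _ _ w); apply: IHn.
    by rewrite card_neq_sig -ltnS prednK //; apply/card_gt0P; exists w.
  exists (fun h => [set x | val x \in phi h]); split=> [h'|h h' /d|h h' /t].
  - exact: conn_del_pull.
  - move=> D; rewrite disjoint_subset; apply/subsetP=> x.
    by rewrite !inE => /(disjointFr D) ->.
  - case=> x [y [xS yS xy]].
    have wN z k : z \in phi k -> z != w by apply: contraTneq => ->.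
    by exists (exist _ x (wN _ _ xS)), (exist _ y (wN _ _ yS)); rewrite !inE.
rewrite negb_exists => /forallP cov.
have /fin_all_exists[f phiE] h : exists x, phi h = [set x].
  apply/cards1P; have [+ _] := c h; rewrite -card_gt0; move: (h1 h).
  by case: #|_| => [|[]].
have fI : injective f.
  move=> h h' E; apply/eqP; apply: contraT => /d.
  by rewrite !phiE E disjoints1 set11.
apply: (@bij_minor _ _ f).
  apply: inj_card_bij => //; rewrite -(card_codom fI); apply/subset_leq_card/subsetP=> x _.
  have := cov x; rewrite negb_forall => /existsP[h]; rewrite negbK phiE inE => /eqP->.
  exact: codom_f.
by move=> h h' /t[x [y]]; rewrite !phiE !inE => -[/eqP-> /eqP->].
Qed.

Lemma touch_sym (G : sgraph) (S T : {set G}) : touch S T -> touch T S.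
Proof. by case=> x [y [xS yT xy]]; exists y, x; rewrite adj_sym. Qed.

(** * Lists of pairs, models given by a list of branch sets, cocktail party structures *)

Definition unpair (T : Type) (ps : seq (T * T)) : seq T :=
  flatten [seq [:: p.1; p.2] | p <- ps].

Lemma size_unpair (T : Type) (ps : seq (T * T)) : size (unpair ps) = (size ps).*2.
Proof. by elim: ps => //= p ps ->. Qed.

Lemma unpair_cat (T : Type) (ps qs : seq (T * T)) :
  unpair (ps ++ qs) = unpair ps ++ unpair qs.
Proof. by rewrite /unpair map_cat flatten_cat. Qed.

(* For [i < j]: in a list starting with the two ends of each of [r] pairs, the
   positions [i] and [j] hold the two ends of the same pair. *)
Definition same_pair (r i j : nat) := (j < r.*2) && (i./2 == j./2).

Lemma matching_pairs (H : sgraph) (r : nat) :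
  r <= matching_number (compl_graph H) ->
  exists ps : seq (H * H),
    [/\ size ps = r, uniq (unpair ps) & all (fun p => ~~ adj p.1 p.2) ps].
Proof.
have [M /andP[ME tM] EM] : exists2 M : {set {set compl_graph H}}, matching M
    & matching_number (compl_graph H) = #|M|.
  have M0 : 0 < #|[pred M : {set {set compl_graph H}} | matching M]|.
    apply/card_gt0P; exists set0.
    by rewrite !inE /matching sub0set /trivIset /cover !big_set0 cards0.
  by have [M mM EM] := eq_bigmax_cond (fun M : {set {set compl_graph H}} => #|M|) M0; exists M.
rewrite EM => rM.
(* The extra clause, that every listed vertex lies in one of the matching edges already treated,
   yields the disjointness from the next edge in the induction. *)
suff [ps [sz up /allP nps _]] : exists ps : seq (H * H),
  [/\ size ps = size (enum M), uniq (unpair ps), all (fun p => ~~ adj p.1 p.2) ps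
    & forall z, z \in unpair ps -> exists2 e, e \in enum M & z \in e].
  exists (take r ps); split.
  - by rewrite size_takel // sz -cardE.
  - by move: up; rewrite -{1}(cat_take_drop r ps) unpair_cat cat_uniq => /andP[].
  - by apply/allP=> p /mem_take/nps.
have : {subset enum M <= M} by move=> e; rewrite mem_enum.
elim: (enum M) (enum_uniq M) => [|e s IHs] /=; first by move=> _ _; exists [::].
move=> /andP[nes us] sM.
have [|ps [sz up nps cps]] := IHs us; first by move=> z zs; apply: sM; rewrite inE zs orbT.
have eM : e \in M by apply: sM; rewrite inE eqxx.
have := subsetP ME e eM; rewrite inE => /existsP[u /existsP[v /andP[/andP[uv nuv] /eqP Ee]]].
have out z : z \in e -> z \notin unpair ps.
  move=> ze; apply/negP=> /cps[e' e's ze'].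
  have ee' : e != e' by apply: contraNneq nes => ->.
  have e'M : e' \in M by apply: sM; rewrite inE e's orbT.
  by have := disjointFr (trivIsetP tM _ _ eM e'M ee') ze; rewrite ze'.
exists ((u, v) :: ps); split=> /=; rewrite ?sz // ?nuv ?nps //.
  by rewrite inE negb_or uv up !out // Ee !inE eqxx ?orbT.
move=> z; rewrite !inE => /or3P[/eqP->|/eqP->|/cps[e' e's ze']].
- by exists e; rewrite ?inE ?eqxx // Ee !inE eqxx.
- by exists e; rewrite ?inE ?eqxx // Ee !inE eqxx orbT.
- by exists e'; rewrite // inE e's orbT.
Qed.

Lemma nth_unpair_nonadj (H : sgraph) (h0 : H) (ps : seq (H * H)) s i j :
  all (fun p => ~~ adj p.1 p.2) ps -> i < j -> same_pair (size ps) i j ->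
  ~~ adj (nth h0 (unpair ps ++ s) i) (nth h0 (unpair ps ++ s) j).
Proof.
rewrite /same_pair; elim: ps i j => //= p ps IHps [|[|i]] [|[|j]] //=; first by case/andP.
- by move=> /andP[_ _] _ /andP[].
- by move=> /andP[_ _] _ /andP[].
by case/andP=> _ nps ij /andP[jr ijE]; apply: IHps => //; apply/andP.
Qed.

(** List the vertices of [H] with [r] disjoint non-adjacent pairs first, and give the vertex at
    position [i] the [i]-th branch set. Two sets at positions of the same pair may fail to touch,
    since [H] has no edge there. *)
Lemma model_of_seq (H G : sgraph) (B : seq {set G}) (r : nat) :
  r <= matching_number (compl_graph H) -> #|H| <= size B ->
  (forall S, S \in B -> conn S) ->
  (forall i j, i < j < size B ->
     [disjoint nth set0 B i & nth set0 B j]) ->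
  (forall i j, i < j < size B -> ~~ same_pair r i j ->
     touch (nth set0 B i) (nth set0 B j)) ->
  model H G.
Proof.
move=> /matching_pairs[ps [sz up nps]] sB cB dB tB.
pose hs := unpair ps ++ [seq h <- enum H | h \notin unpair ps].
have hsT h : h \in hs.
  by rewrite mem_cat mem_filter mem_enum andbT orbN.
have hsU : uniq hs.
  rewrite cat_uniq up filter_uniq ?enum_uniq // andbT /=.
  by apply/hasPn=> h; rewrite mem_filter => /andP[].
have hsS : size hs = #|H|.
  by rewrite -(card_uniqP hsU); apply: eq_card => h; rewrite hsT.
have iB h : index h hs < size B by rewrite (leq_trans _ sB) // -hsS index_mem.
have idxI h h' : index h hs = index h' hs -> h = h'.
  by move/(congr1 (nth h hs)); rewrite !nth_index.
exists (fun h => nth set0 B (index h hs)); split.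
- by move=> h; apply: cB; apply: mem_nth.
- move=> h h' hh; wlog: h h' hh / index h hs < index h' hs.
    move=> W; case: (ltngtP (index h hs) (index h' hs)) => [|hh'|/idxI E].
    + exact: W.
    + by rewrite disjoint_sym W // eq_sym.
    + by rewrite E eqxx in hh.
  by move=> lt; apply: dB; rewrite lt iB.
- move=> h h' hh; wlog: h h' hh / index h hs < index h' hs.
    move=> W; case: (ltngtP (index h hs) (index h' hs)) => [|hh'|/idxI E].
    + exact: W.
    + by apply: touch_sym; apply: W => //; rewrite adj_sym.
    + by rewrite E adj_irrefl in hh.
  move=> lt; apply: tB; rewrite ?lt ?iB //; apply/negP; rewrite -sz => sp.
  have := nth_unpair_nonadj h [seq h <- enum H | h \notin unpair ps] nps lt sp.
  by rewrite -/hs !nth_index // hh.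
Qed.

(* [ps] and [qs] list the vertices of an induced subgraph whose complement has
   at most the pairs in [ps] as edges. *)
Fixpoint cocktail (G : sgraph) (ps : seq (G * G)) (qs : seq G) : bool :=
  if ps is p :: ps' then
    [&& p.1 != p.2, all (fun z => adj p.1 z && adj p.2 z) (unpair ps' ++ qs)
      & cocktail ps' qs]
  else pairwise (@adj G) qs.

(** A surplus pair is turned into a single vertex by forgetting its second end; this serves when
    there are more pairs than a matching in the complement of [H] can absorb. *)
Lemma cocktail_drop (G : sgraph) (ps1 ps2 : seq (G * G)) (qs : seq G) :
  cocktail (ps1 ++ ps2) qs -> cocktail ps1 ([seq p.1 | p <- ps2] ++ qs).
Proof.
elim: ps1 => [|p ps1 IH] /=.
  elim: ps2 => //= p ps2 IH /and3P[_ /allP a /IH->]; rewrite andbT.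
  apply/allP=> z zs; suff /a/andP[] : z \in unpair ps2 ++ qs by [].
  move: zs; rewrite !mem_cat => /orP[|->]; last by rewrite orbT.
  case/mapP=> q qs2 ->; apply/orP; left; apply/flattenP.
  by exists [:: q.1; q.2]; rewrite ?inE ?eqxx //; apply: map_f.
case/and3P=> -> /allP a /IH->; rewrite andbT /=.
apply/allP=> z zs; apply: a; move: zs; rewrite unpair_cat !mem_cat.
case/or3P=> [->//||->]; last by rewrite !orbT.
case/mapP=> q qs2 ->; apply/orP; left; apply/orP; right; apply/flattenP.
by exists [:: q.1; q.2]; rewrite ?inE ?eqxx //; apply: map_f.
Qed.

Lemma cocktail_uniq (G : sgraph) (ps : seq (G * G)) qs :
  cocktail ps qs -> uniq (unpair ps ++ qs).
Proof.
elim: ps => [|p ps IH] /=.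
  by apply: pairwise_uniq => x; rewrite adj_irrefl.
case/and3P=> p12 /allP a /IH->; rewrite inE negb_or p12 andbT /=.
by apply/andP; split; apply/negP=> /a; rewrite adj_irrefl ?andbF.
Qed.

Lemma cocktail_nth (G : sgraph) (x0 : G) (ps : seq (G * G)) qs i j :
  cocktail ps qs -> i < j < size (unpair ps ++ qs) ->
  ~~ same_pair (size ps) i j ->
  adj (nth x0 (unpair ps ++ qs) i) (nth x0 (unpair ps ++ qs) j).
Proof.
elim: ps i j => [|p ps IH] i j /=.
  by move=> /(pairwiseP x0) pw /andP[ij js] _; apply: pw; rewrite ?inE //; exact: ltn_trans js.
case/and3P=> p12 /allP a c; case: j => [|[|j]]; case: i => [|[|i]] //=; rewrite ?ltnS.
- by move=> js _; have /a/andP[] : nth x0 (unpair ps ++ qs) j \in unpair ps ++ qs by apply: mem_nth.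
- by move=> js _; have /a/andP[] : nth x0 (unpair ps ++ qs) j \in unpair ps ++ qs by apply: mem_nth.
by move=> ijs; apply: IH.
Qed.

(** * Minors of graphs with small non-degrees *)

Definition nbh (G : sgraph) (v : G) : {set G} := [set u | adj v u].

(* Two vertices without a common non-neighbour dominate [A], and a vertex shares a
   non-neighbour with at most [D * D] vertices. *)
Lemma dominating_pairs (G : sgraph) (D : nat) (A R : {set G}) :
  R \subset A -> {in A, forall v, #|A :\: nbh v| <= D} ->
  exists rs : seq (G * G),
    [/\ uniq (unpair rs), {subset unpair rs <= R}, #|R| <= (size rs).*2 + D * D
      & forall p z, p \in rs -> z \in A -> adj p.1 z || adj p.2 z].
Proof.
move=> + dA; have [n] := ubnP #|R|; elim: n => // n IHn in R * => Rn RA.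
have [RD|RD] := leqP #|R| (D * D); first by exists [::].
have /card_gt0P[a aR] : 0 < #|R| by lia.
have aA := subsetP RA _ aR.
pose C := \bigcup_(w in A :\: nbh a) (A :\: nbh w).
have cC : #|C| <= D * D.
  apply: leq_trans (_ : \sum_(w in A :\: nbh a) #|A :\: nbh w| <= _).
    rewrite /C; elim/big_rec2: _ => [|w m T _ le]; first by rewrite cards0.
    by rewrite (leq_trans (leq_card_setU _ _)) // leq_add2l.
  apply: leq_trans (_ : \sum_(w in A :\: nbh a) D <= _).
    by apply: leq_sum => w; rewrite inE => /andP[_]; apply: dA.
  by rewrite sum_nat_const leq_mul2r dA ?orbT.
have /subsetPn[b bR bC] : ~~ (R \subset C).
  by apply: contraTN RD => /subset_leq_card; lia.
have bA := subsetP RA _ bR.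
have ab w : w \in A -> adj a w || adj b w.
  move=> wA; apply: contraR bC; rewrite negb_or => /andP[aw bw].
  by apply/bigcupP; exists w; rewrite !inE ?wA ?bA ?aw // adj_sym bw.
(* A vertex is its own non-neighbour, so [a] lies in [C] while [b] does not. *)
have nab : a != b.
  by apply: contraNneq bC => <-; apply/bigcupP; exists a; rewrite !inE adj_irrefl aA.
have cR : #|R| = #|R :\ a :\ b|.+2.
  by rewrite (cardsD1 a) aR (cardsD1 b (R :\ a)) !inE eq_sym nab bR.
have [||rs [urs srs crs drs]] := IHn (R :\ a :\ b).
- by move: Rn; rewrite cR; lia.
- by apply: subset_trans RA; rewrite !subDset; apply/subsetP=> z; rewrite !inE => ->; rewrite !orbT.
exists ((a, b) :: rs); split=> /=.
- rewrite inE negb_or nab urs andbT /=.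
  by apply/andP; split; apply/negP=> /srs; rewrite !inE eqxx ?andbF.
- by move=> z; rewrite !inE => /or3P[/eqP->|/eqP->|/srs] //; rewrite !inE => /and3P[].
- by rewrite cR; lia.
- by move=> p z; rewrite inE => /orP[/eqP->|/drs]; [apply: ab|apply].
Qed.

(** The vertices of [ps] and [qs] as singletons, together with dominating pairs from the rest of
    [A], are branch sets that touch except inside the pairs of [ps]. Their number must therefore
    stay below [#|H|], and all but [D * D] vertices of the rest are paired. *)
Lemma cocktail_minor_bound (H G : sgraph) (D : nat) (A : {set G}) ps qs :
  {in A, forall v, #|A :\: nbh v| <= D} ->
  cocktail ps qs -> {subset unpair ps ++ qs <= A} ->
  size ps <= matching_number (compl_graph H) -> ~ model H G ->
  #|A| + size (unpair ps ++ qs) <= (#|H|).*2 + D * D.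
Proof.
set us := unpair ps ++ qs => dA cpq sA rx nHG.
have uU : uniq us := cocktail_uniq cpq.
have [|rs [urs srs crs drs]] := @dominating_pairs _ D A (A :\: [set z in us]) _ dA.
  exact: subsetDl.
have AE : #|A| <= size us + #|A :\: [set z in us]|.
  have <- : #|[set z in us]| = size us by rewrite cardsE; exact/card_uniqP.
  by rewrite -(cardsID [set z in us] A) leq_add2r subset_leq_card // subsetIr.
suff : ~~ (#|H| <= size us + size rs) by lia.
apply/negP => le; apply: nHG.
(* [nth] needs a default vertex; if [G] has none, then [H] has none either. *)
have [x0 _|G0] := pickP (fun x : G => true); last first.
  have us0 : size us = 0 by case: us {AE uU sA le rx cpq srs crs} => // y; have := G0 y.
  have rs0 : size rs = 0 by case: rs {le urs srs crs drs} => // y; have := G0 y.1.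
  have H0 : #|H| = 0 by lia.
  by exists (fun=> set0); split=> h; have := max_card (pred1 h); rewrite H0 card1.
pose B := [seq [set v] | v <- us] ++ [seq [set p.1; p.2] | p <- rs].
have sB : size B = size us + size rs by rewrite size_cat !size_map.
have pA p : p \in rs -> p.1 \in A :\: [set z in us] /\ p.2 \in A :\: [set z in us].
  move=> prs; split; apply: srs; apply/flattenP; exists [:: p.1; p.2];
    by rewrite ?inE ?eqxx ?orbT //; apply: map_f.
have Bl i : i < size us -> nth set0 B i = [set nth x0 us i].
  by move=> ius; rewrite nth_cat size_map ius (nth_map x0).
have Br i : size us <= i < size B ->
    exists2 p, p \in rs & nth set0 B i = [set p.1; p.2].
  rewrite sB => /andP[ui iB]; rewrite nth_cat size_map ltnNge ui /=.
  have ir : i - size us < size rs by lia.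
  by exists (nth (x0, x0) rs (i - size us)); rewrite ?mem_nth // (nth_map (x0, x0)).
have dom p w : p \in rs -> w \in A -> exists2 y, y \in [set p.1; p.2] & adj w y.
  move=> prs wA; have /orP[a|a] := drs p w prs wA; [exists p.1|exists p.2];
    by rewrite ?inE ?eqxx ?orbT // adj_sym.
have dB i j : i < j < size B -> [disjoint nth set0 B i & nth set0 B j].
  case/andP=> ij jB; have [ju|uj] := ltnP j (size us).
    have iu : i < size us by apply: ltn_trans ju.
    by rewrite !Bl // disjoints1 inE nth_uniq // neq_ltn ij.
  have ujB : size us <= j < size B by rewrite uj jB.
  have [iu|ui] := ltnP i (size us).
    rewrite Bl // disjoints1; have [p prs ->] := Br j ujB.
    have [] := pA p prs; rewrite !inE => /andP[n1 _] /andP[n2 _].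
    rewrite negb_or; apply/andP; split.
      by apply: contraNneq n1 => <-; rewrite mem_nth.
    by apply: contraNneq n2 => <-; rewrite mem_nth.
  rewrite !nth_cat !size_map !ltnNge ui uj /=.
  have ij' : i - size us < j - size us by lia.
  have jr : j - size us < size rs by lia.
  move: (i - _) (j - _) ij' jr => {ij jB uj ujB ui} {}i {}j ij jr.
  rewrite !(nth_map (x0, x0)) //; last exact: ltn_trans jr.
  elim: rs i j ij jr urs {srs crs drs le B sB pA Bl Br dom} => // p rs IH [|i] [|j] //=; last first.
    by move=> ij jr /and3P[_ _ u]; apply: IH.
  move=> _ jr /and3P[]; rewrite inE negb_or => /andP[_ n1] n2 _.
  have qrs : nth (x0, x0) rs j \in rs by apply: mem_nth.
  set q := nth _ _ _ in qrs *.
  have q12 z : z \in [set q.1; q.2] -> z \in unpair rs.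
    rewrite !inE => zq; apply/flattenP; exists [:: q.1; q.2]; rewrite ?inE //.
    exact: map_f.
  rewrite disjoint_subset; apply/subsetP=> z; rewrite !inE => /orP[]/eqP->.
    by apply: contra n1 => z2; apply: q12; rewrite !inE.
  by apply: contra n2 => z2; apply: q12; rewrite !inE.
have cB S : S \in B -> conn S.
  rewrite mem_cat => /orP[]/mapP[]; first by move=> v _ ->; apply: conn1.
  move=> p prs ->; have [] := pA p prs; rewrite inE => /andP[_ p1A] _.
  (* The pair dominates its own first end, which is not adjacent to itself, so the two ends are
     adjacent. *)
  have := drs p p.1 prs p1A; rewrite adj_irrefl /= adj_sym; exact: conn2.
apply: (@model_of_seq _ _ B (size ps)) => //; first by rewrite sB.
move=> i j /andP[ij jB] nsp; have [ju|uj] := ltnP j (size us).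
  have iu : i < size us by apply: ltn_trans ju.
  rewrite !Bl //; exists (nth x0 us i), (nth x0 us j); rewrite !inE; split=> //.
  by apply: cocktail_nth => //; rewrite ij.
have [p prs ->] := Br j (introT andP (conj uj jB)).
have [w wi wA] : exists2 w, w \in nth set0 B i & w \in A.
  have [iu|ui] := ltnP i (size us).
    by exists (nth x0 us i); rewrite ?Bl ?inE // sA // mem_nth.
  have [|p' prs' ->] := Br i; first by rewrite ui (ltn_trans ij jB).
  exists p'.1; first by rewrite !inE eqxx.
  by have [] := pA p' prs'; rewrite inE => /andP[].
by have [y yp wy] := dom p w prs wA; exists w, y.
Qed.

(** * Degeneracy of graphs without a given minor *)

Definition cnbh (G : sgraph) (v : G) : {set G} := v |: nbh v.

Definition dominated (G : sgraph) (T : {set G}) : {set G} := \bigcup_(y in T) cnbh y.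

(** Each undominated vertex lies in at least [d.+1], so in a third of all, closed neighbourhoods of
    vertices of [J]. By averaging some closed neighbourhood contains a third of the undominated
    vertices, and each choice shrinks their number to at most two thirds. *)
Lemma greedy_domination (G : sgraph) (J : {set G}) (d : nat) :
  {in J, forall x, d <= #|J :&: nbh x|} -> #|J| <= 3 * d.+1 ->
  forall j, exists T : {set G},
    [/\ T \subset J, #|T| <= j & #|J :\: dominated T| * 3 ^ j <= #|J| * 2 ^ j].
Proof.
move=> dJ cJ; elim=> [|j [T [TJ Tj XT]]].
  by exists set0; rewrite sub0set cards0 /dominated big_set0 setD0.
set X := J :\: dominated T in XT.
have [X0|X0] := eqVneq X set0.
  by exists T; split; rewrite -/X ?X0 ?cards0 // ltnW.
have [y yJ yX] : exists2 y, y \in J & #|X| <= 3 * #|X :&: cnbh y|.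
  apply/exists_inP; apply: contraT; rewrite negb_exists_in => /forall_inP h.
  have J0 : 0 < #|J|.
    by case/set0Pn: X0 => x; rewrite inE => /andP[_ xJ]; apply/card_gt0P; exists x.
  have : \sum_(y in J) 3 * #|X :&: cnbh y| < \sum_(y in J) #|X|.
    case/card_gt0P: J0 => y yJ; rewrite (bigD1 y) //= [X in _ < X](bigD1 y) //=.
    rewrite -addSn leq_add ?ltnNge ?h //; apply: leq_sum => z /andP[zJ _].
    by apply: ltnW; rewrite ltnNge h.
  rewrite sum_nat_const -big_distrr /= ltnNge => /negP[].
  apply: leq_trans (_ : 3 * (#|X| * d.+1) <= _).
    by rewrite mulnCA mulnC leq_mul2l cJ orbT.
  rewrite leq_mul2l /=.
  (* Double counting of the pairs in the closed neighbourhood relation. *)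
  have -> : \sum_(i in J) #|X :&: cnbh i| = \sum_(x in X) #|J :&: cnbh x|.
    under eq_bigr do rewrite -sum1_card; under [RHS]eq_bigr do rewrite -sum1_card.
    rewrite (exchange_big_dep (fun x => x \in X)) /=; last by move=> i x _; rewrite inE => /andP[].
    apply: eq_bigr => x xX; apply: eq_bigl => i; rewrite !in_setI xX /=.
    by rewrite !inE eq_sym adj_sym.
  rewrite -sum_nat_const; apply: leq_sum => x; rewrite inE => /andP[_ xJ].
  have -> : J :&: cnbh x = x |: (J :&: nbh x).
    by apply/setP=> z; rewrite !inE; case: eqP => // ->; rewrite xJ.
  by rewrite cardsU1 !inE adj_irrefl andbF ltnS dJ.
exists (y |: T); split.
- by rewrite subUset sub1set yJ.
- by rewrite cardsU1; case: (y \notin T) => /=; lia.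
have -> : J :\: dominated (y |: T) = X :\: cnbh y.
  by rewrite /X setDDl setUC /dominated bigcup_setU big_set1.
have := cardsID (cnbh y) X; rewrite !expnS; move: XT yX.
move: #|X| #|X :&: _| #|X :\: _| (3 ^ j) (2 ^ j) #|J| => a b c p q m; clear => h1 h2 h3.
have : c * 3 <= a * 2 by lia.
by nia.
Qed.

(** An edge [ab] leaves the part of [J] dominated by [C], and some [t] of [T] dominates [b]. Adding
    [a], [b] and [t] to [C] keeps it connected and captures [t], which was outside [C] because [C]
    does not dominate [b]. *)
Lemma connected_extension (G : sgraph) (J T C : {set G}) : conn J -> T \subset J ->
  J \subset dominated T -> conn C -> C \subset J -> ~~ (J \subset dominated C) ->
  exists C' : {set G},
    [/\ conn C', C' \subset J, #|C'| <= #|C| + 3 & #|T :\: C'| < #|T :\: C|].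
Proof.
move=> cJ TJ dT cC CJ ndC.
have [a [b [aA bA ab]]] : exists a b, [/\ a \in J :&: dominated C,
    b \in J :\: (J :&: dominated C) & adj a b].
  apply: cJ.2; first exact: subsetIl.
    have /set0Pn[c cC'] := cC.1; apply/set0Pn; exists c; rewrite inE (subsetP CJ) //=.
    by apply/bigcupP; exists c; rewrite ?inE ?eqxx.
  by apply: contraNneq ndC => /setIidPl.
move: aA bA; rewrite !inE => /andP[aJ aC] /andP[+ bJ]; rewrite bJ /= => bC.
have /bigcupP[t tT bt] := subsetP dT b bJ.
have tC : t \notin C by apply: contra bC => tC; apply/bigcupP; exists t.
have [c cC' ca] : exists2 c, c \in C & adj a c.
  case/bigcupP: aC => c cC'; rewrite !inE => /orP[/eqP E|]; last by rewrite adj_sym; exists c.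
  by case/negP: bC; apply/bigcupP; exists a; rewrite ?E // -E !inE ab orbT.
have cbaC : conn (b |: (a |: C)).
  apply: (@conn_add _ _ b a); rewrite ?inE ?eqxx // 1?adj_sym //.
  exact: conn_add ca.
exists (t |: (b |: (a |: C))); split.
- move: bt; rewrite !inE => /orP[/eqP E|tb]; first by rewrite -E setUA setUid.
  by apply: (@conn_add _ _ t b); rewrite ?inE ?eqxx.
- by rewrite !subUset !sub1set aJ bJ CJ (subsetP TJ).
- by rewrite !cardsU1; do 3!case: (_ \notin _) => /=; clear; lia.
apply/proper_card/properP; split; first by apply: setDS; rewrite !setUA subsetUr.
by exists t; rewrite !inE ?tC ?tT ?eqxx.
Qed.

Lemma connected_domination (G : sgraph) (J T : {set G}) : conn J -> T \subset J ->
  J \subset dominated T ->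
  exists C : {set G}, [/\ conn C, C \subset J, J \subset dominated C & #|C| <= 3 * #|T| + 1].
Proof.
move=> cJ TJ dT; suff step n : forall C : {set G}, #|T :\: C| <= n -> conn C -> C \subset J ->
    exists C' : {set G}, [/\ conn C', C' \subset J, J \subset dominated C' & #|C'| <= #|C| + 3 * n].
  have /set0Pn[x xJ] := cJ.1.
  have [|C [cC CJ dC sC]] := step _ [set x] (leqnn _) (conn1 x); first by rewrite sub1set.
  exists C; split=> //; apply: leq_trans sC _; rewrite cards1 addnC leq_add2r leq_mul2l.
  by rewrite subset_leq_card ?subsetDl.
elim: n => [|n IHn] C TC cC CJ; have [dC|ndC] := boolP (J \subset dominated C);
  try by exists C; split=> //; rewrite leq_addr.
  have [C' [_ _ _]] := connected_extension cJ TJ dT cC CJ ndC.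
  by rewrite ltnNge (leq_trans TC).
have [C' [cC' CJ' sC' lt]] := connected_extension cJ TJ dT cC CJ ndC.
have [|C2 [h1 h2 h3 h4]] := IHn C' _ cC' CJ'; first exact: leq_trans lt TC.
exists C2; split=> //; apply: leq_trans h4 _.
by rewrite mulnS addnA leq_add2r.
Qed.

(** A component, obtained as a smallest nonempty subset closed under adjacency inside [J]. *)
Lemma connected_part (G : sgraph) (J : {set G}) : J != set0 ->
  exists P : {set G}, [/\ conn P, P \subset J & {in P, forall x, J :&: nbh x \subset P}].
Proof.
pose closed (P : {set G}) := [&& P != set0, P \subset J & [forall x in P, J :&: nbh x \subset P]].
move=> J0; have cJ : closed J.
  by rewrite /closed J0 subxx; apply/forall_inP=> x _; apply: subsetIl.
have [P /and3P[P0 PJ /forall_inP cP] minP] := arg_minnP (fun P : {set G} => #|P|) cJ.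
exists P; split=> //; split=> // Q QP Q0 QnP.
have [/exists_inP[x xQ /exists_inP[y yP xy]]|n] :=
    boolP [exists x in Q, exists y in P :\: Q, adj x y].
  by exists x, y.
have : closed Q.
  rewrite /closed Q0 (subset_trans QP PJ); apply/forall_inP=> x xQ.
  apply/subsetP=> y yx; have yP := subsetP (cP x (subsetP QP _ xQ)) y yx.
  apply: contraR n => yQ; apply/exists_inP; exists x => //; apply/exists_inP; exists y.
    by rewrite inE yQ.
  by move: yx; rewrite !inE => /andP[].
move=> /minP; rewrite leqNgt proper_card // properEneq QnP QP //.
Qed.

(** Take a component [P] and a connected set [C] dominating it, with at most [3 * l + 1] vertices,
    and continue inside [P :\: C]. All later sets touch [C] by domination, and the minimum degree
    drops by at most [3 * l + 1] per round, for which the last hypothesis leaves room. *)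
Lemma dense_touching (G : sgraph) (l M : nat) : M * 2 ^ l < 3 ^ l ->
  forall i (J : {set G}) d, J != set0 -> #|J| <= M ->
  {in J, forall x, d <= #|J :&: nbh x|} -> M + 3 * (i * (3 * l + 1)) <= 3 * d ->
  exists B : seq {set G},
    [/\ size B = i, forall S, S \in B -> conn S /\ S \subset J
      & forall a b, a < b < size B ->
          [disjoint nth set0 B a & nth set0 B b] /\ touch (nth set0 B a) (nth set0 B b)].
Proof.
move=> Ml; elim=> [|i IHi] J d J0 JM dJ Md.
  by exists [::]; split=> // a b /andP[].
have [P [cP PJ clP]] := connected_part J0.
have dP x : x \in P -> d <= #|P :&: nbh x|.
  move=> xP; apply: leq_trans (dJ x (subsetP PJ _ xP)) _; apply: subset_leq_card.
  by rewrite subsetI clP // subsetIr.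
have PM : #|P| <= M := leq_trans (subset_leq_card PJ) JM.
have [|T [TP Tl XT]] := greedy_domination dP _ l; first by lia.
(* After [l] greedy choices fewer than one vertex is undominated, as [M * 2 ^ l < 3 ^ l]. *)
have {}XT : P \subset dominated T.
  rewrite -setD_eq0 -cards_eq0; case: #|_ :\: _| XT => // a XT.
  have := leq_ltn_trans XT (leq_ltn_trans (_ : _ <= M * 2 ^ l) Ml).
  by rewrite leq_mul2r PM orbT => /(_ isT); rewrite mulSn ltnNge leq_addr.
have [C [cC CP dC sC]] := connected_domination cP TP XT.
have sC' : #|C| <= 3 * l + 1 by lia.
have /set0Pn[x xP] := cP.1.
have [||||B [sB cB pB]] := IHi (P :\: C) (d - (3 * l + 1)).
- rewrite -card_gt0 cardsD subn_gt0.
  have := dP x xP; have := subset_leq_card (subsetIl P (nbh x)).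
  have := subset_leq_card (subsetIr P C); lia.
- by rewrite (leq_trans _ PM) // subset_leq_card // subsetDl.
- move=> y; rewrite inE => /andP[_ /dP dy]; rewrite leq_subLR; apply: leq_trans dy _.
  rewrite -(cardsID C); apply: leq_add.
    by apply: leq_trans sC'; rewrite subset_leq_card // subsetIr.
  by rewrite setIDAC.
- by lia.
exists (C :: B); split=> [|S|] /=; first by rewrite sB.
  rewrite inE => /orP[/eqP->|/cB[cS SP]]; first by rewrite (subset_trans CP PJ).
  by split=> //; apply: subset_trans SP (subset_trans (subsetDl _ _) PJ).
move=> [|a] [|b] //=; last by rewrite !ltnS; apply: pB.
rewrite ltnS => bB; have [[/set0Pn[y yS] _] SP] := cB _ (mem_nth set0 bB).
split.
  rewrite disjoint_sym disjoint_subset; apply/subsetP=> z /(subsetP SP).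
  by rewrite !inE => /andP[].
have := subsetP SP y yS; rewrite inE => /andP[yC yP].
have /bigcupP[c cC'] := subsetP dC y yP; rewrite !inE => /orP[/eqP E|cy].
  by rewrite E cC' in yC.
by exists c, y.
Qed.

(** * Mader's contraction argument, with each edge counted as two arcs *)

Definition arcs (G : sgraph) : {set G * G} := [set p | adj p.1 p.2].

Lemma card_arcs (G : sgraph) : #|arcs G| = \sum_(v : G) #|nbh v|.
Proof.
rewrite -sum1_card (eq_bigl (fun p => (p.1 \in [set: G]) && (p.2 \in nbh p.1))).
  rewrite -(pair_big_dep (fun v => v \in [set: G]) (fun v u => u \in nbh v) (fun _ _ => 1)) /=.
  by apply: eq_big => v; rewrite ?inE // sum1_card.
by move=> p; rewrite !inE.
Qed.

Lemma arcs_del_edge (G : sgraph) (u v : G) :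
  #|arcs G| <= #|arcs (del_edge u v)| + 2.
Proof.
apply: leq_trans (_ : #|arcs (del_edge u v) :|: [set (u, v); (v, u)]| <= _).
  apply/subset_leq_card/subsetP=> -[x y]; rewrite !inE /= /del_edge_adj => xy.
  rewrite xy /=; have [E|//] := eqVneq [set x; y] [set u; v].
  have : x \in [set u; v] by rewrite -E !inE eqxx.
  have : y \in [set u; v] by rewrite -E !inE eqxx orbT.
  rewrite !inE !xpair_eqE => /orP[]/eqP yE /orP[]/eqP xE; rewrite xE yE ?eqxx ?orbT //;
    by move: xy; rewrite xE yE adj_irrefl.
apply: leq_trans (leq_card_setU _ _) _.
by rewrite leq_add2l cards2; case: (_ != _).
Qed.

Lemma arcs_del_isolated (G : sgraph) (w : G) :
  nbh w = set0 -> #|arcs (del_vertex w)| = #|arcs G|.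
Proof.
move=> w0; have nw u : adj w u = false.
  by have := congr1 (fun A : {set G} => u \in A) w0; rewrite !inE.
have fI : injective (fun p : del_vertex w * del_vertex w => (val p.1, val p.2)).
  by move=> [a b] [c d] [/val_inj-> /val_inj->].
rewrite -(card_imset _ fI); apply: eq_card => -[x y]; apply/imsetP/idP.
  by case=> -[a b] + [-> ->]; rewrite !inE.
rewrite inE /= => xy.
have xw : x != w by apply: contraTneq xy => ->; rewrite nw.
have yw : y != w by apply: contraTneq xy => ->; rewrite adj_sym nw.
by exists (exist _ x xw, exist _ y yw); rewrite ?inE.
Qed.

Lemma rep_eq (G : sgraph) (u v : G) (uv : adj u v) x y : rep uv x = rep uv y ->
  [\/ x = y, x = u /\ y = v | x = v /\ y = u].
Proof.
move/(congr1 val); rewrite !val_rep.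
by case: (eqVneq x v) => [->|_]; case: (eqVneq y v) => [->|_] E;
  [constructor 1|constructor 3|constructor 2|constructor 1].
Qed.

(** Outside [bad] the quotient map is injective on arcs: [bad] holds the two arcs between [u] and
    [v] and, for each common neighbour [w], the two arcs between [v] and [w], which get identified
    with those between [u] and [w]. *)
Lemma arcs_contract (G : sgraph) (u v : G) : adj u v ->
  #|arcs G| <= #|arcs (contract u v)| + 2 + 2 * #|nbh u :&: nbh v|.
Proof.
move=> uv; pose W := nbh u :&: nbh v.
pose bad := [set (u, v); (v, u)] :|: [set (v, w) | w in W] :|: [set (w, v) | w in W].
have cbad : #|bad| <= 2 + 2 * #|W|.
  apply: leq_trans (leq_card_setU _ _) _; rewrite mul2n -addnn addnA.
  apply: leq_add; last exact: leq_imset_card.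
  apply: leq_trans (leq_card_setU _ _) _.
  by apply: leq_add; [rewrite cards2; case: (_ != _)|exact: leq_imset_card].
rewrite -addnA -(cardsID bad) addnC leq_add //; last first.
  by apply: leq_trans cbad; rewrite subset_leq_card // subsetIr.
have badE x y : adj x y -> (x, y) \notin bad ->
    [/\ ~~ (adj u y && (x == v)), ~~ (adj u x && (y == v)), (x, y) != (u, v) & (x, y) != (v, u)].
  move=> xy bxy; split; apply: contra bxy.
  - case/andP=> uy /eqP E; rewrite !in_setU; apply/orP; left; apply/orP; right.
    by apply/imsetP; exists y; rewrite ?E // !inE uy -E xy.
  - case/andP=> ux /eqP E; rewrite !in_setU; apply/orP; right.
    by apply/imsetP; exists x; rewrite ?E // !inE ux -E adj_sym xy.
  - by move/eqP->; rewrite !inE eqxx.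
  - by move/eqP->; rewrite !inE eqxx orbT.
pose psi (p : G * G) : contract u v * contract u v := (rep uv p.1, rep uv p.2).
have psiI : {in arcs G :\: bad &, injective psi}.
  move=> [x y] [x' y']; rewrite !in_setD => /andP[bxy +] /andP[bxy' +]; rewrite !inE /=.
  move=> xy xy' [/rep_eq Ex /rep_eq Ey].
  have [n1 n2 n3 n4] := badE _ _ xy bxy; have [n1' n2' _ _] := badE _ _ xy' bxy'.
  case: Ex Ey n1 n2 n3 n4 n1' n2' xy xy' => [->|[-> ->]|[-> ->]] [->|[-> ->]|[-> ->]] //;
    rewrite ?eqxx ?andbT ?adj_irrefl // => n1 n2 _ _ n1' n2' xy xy'.
  - by rewrite adj_sym xy in n2'.
  - by rewrite adj_sym xy' in n2.
  - by rewrite xy in n1'.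
  - by rewrite xy' in n1.
rewrite -(card_in_imset psiI); apply/subset_leq_card/subsetP=> _ /imsetP[[x y] xyP ->].
move: xyP; rewrite inE => /andP[xyb]; rewrite !inE /= => xy.
apply: adj_rep => //; apply: contraNneq xyb => E.
have := congr1 val E; rewrite !val_rep.
rewrite /bad !inE !xpair_eqE; move: xy.
case: (eqVneq x v) => [->|]; case: (eqVneq y v) => [->|] //=; rewrite ?adj_irrefl //.
- by move=> _ _ <-; rewrite !eqxx ?orbT.
- by move=> _ _ ->; rewrite !eqxx ?orbT.
by move=> _ _ + E'; rewrite E' adj_irrefl.
Qed.

(** An edge with fewer than [k] common neighbours is contracted, at a loss of at most [2 * k] arcs
    for one vertex. If there is none, a vertex of positive degree at most [2 * k] has a
    neighbourhood of minimum degree at least [k], where [dense_touching] finds a complete minor on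
    [#|H|] vertices. *)
Lemma minor_of_arcs (H G : sgraph) (k l : nat) :
  0 < k -> 2 * k * 2 ^ l < 3 ^ l -> 3 * (#|H| * (3 * l + 1)) <= k ->
  0 < #|G| -> 2 * k * #|G| <= #|arcs G| -> minor H G.
Proof.
move=> k0 kl kH; have [n] := ubnP #|G|; elim: n => // n IHn in G *.
have [m] := ubnP #|arcs G|; elim: m => // m IHm in G *.
rewrite !ltnS => Gm Gn G0 GE.
have a0 : 0 < #|arcs G| by apply: leq_trans GE; rewrite !muln_gt0 k0.
have G1 : 1 < #|G|.
  case/card_gt0P: a0 => -[u v]; rewrite inE /= => uv.
  by rewrite (cardD1 u) (cardD1 v) !inE eq_sym (edge_neq uv).
have [/existsP[u /existsP[v /andP[uv small]]]|noc] :=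
    boolP [exists u : G, exists v : G, adj u v && (#|nbh u :&: nbh v| < k)].
  have cC : #|contract u v| = #|G|.-1 := card_neq_sig v.
  have := arcs_contract uv => le.
  apply: (minor_contract uv); apply: IHn; rewrite cC; [lia|lia|].
  rewrite -subn1 mulnBr muln1; lia.
(* If all degrees exceed [2 * k], there are [#|G|], hence at least two, arcs to spare, and an edge
   can be deleted. *)
have [/forallP deg|] := boolP [forall v : G, 2 * k < #|nbh v|].
  have G2 : 2 * k * #|G| + #|G| <= #|arcs G|.
    rewrite card_arcs addnC -mulSn mulnC -cardsT -sum_nat_const.
    by rewrite (eq_bigl xpredT); [apply: leq_sum => v _; exact: deg | move=> v; rewrite inE].
  case/card_gt0P: a0 => -[u v]; rewrite inE /= => uv; apply: (minor_del_edge uv).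
  apply: IHm => //; last by have := arcs_del_edge u v; rewrite -/(#|G|); lia.
  apply: leq_trans Gm; apply: proper_card; apply/properP; split.
    by apply/subsetP=> p; rewrite !inE => /andP[].
  by exists (u, v); rewrite !inE //= /del_edge_adj eqxx andbF.
rewrite negb_forall => /existsP[v]; rewrite -leqNgt => dv.
have [v0|v0] := eqVneq (nbh v) set0.
  apply: (@minor_del_vertex _ _ v); have cD : #|del_vertex v| = #|G|.-1 := card_neq_sig v.
  apply: IHn; rewrite cD ?arcs_del_isolated //; [lia|lia|].
  by apply: leq_trans GE; rewrite leq_mul2l leq_pred orbT.
have [||B [sB cB pB]] := @dense_touching G l (2 * k) kl #|H| (nbh v) k v0 dv.
- move=> u; rewrite inE => vu; move: noc; rewrite negb_exists => /forallP/(_ v).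
  by rewrite negb_exists => /forallP/(_ u); rewrite vu -leqNgt.
- by lia.
apply: model_minor; apply: (@model_of_seq _ _ B 0); rewrite ?leq0n ?sB //.
- by move=> S /cB[].
- by move=> i j; rewrite -sB => /pB[].
- by move=> i j; rewrite -sB => /pB[].
Qed.

Section Induced.
Variables (G : sgraph) (A : {set G}).

Definition induced_adj : rel {x : G | x \in A} := fun x y => adj (val x) (val y).

Lemma induced_sym : symmetric induced_adj.
Proof. by move=> x y; apply: adj_sym. Qed.

Lemma induced_irrefl : irreflexive induced_adj.
Proof. by move=> x; apply: adj_irrefl. Qed.

Definition induced : sgraph := SGraph induced_sym induced_irrefl.

Lemma card_induced_nbh (v : induced) : #|nbh v| = #|A :&: nbh (val v)|.
Proof.
rewrite -(card_imset _ (val_inj : injective (val : induced -> G))).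
apply: eq_card => x; apply/imsetP/idP.
  by case=> y + ->; rewrite !inE (valP y).
by rewrite !inE => /andP[xA vx]; exists (exist _ x xA); rewrite // inE.
Qed.

Lemma minor_induced (H : sgraph) : minor H induced -> minor H G.
Proof.
move=> /minor_model m; apply: model_minor.
by apply: (@model_lift H G induced val) m => //; exact: val_inj.
Qed.
End Induced.

Lemma degenerate_of_no_minor (H G : sgraph) (k l : nat) :
  0 < k -> 2 * k * 2 ^ l < 3 ^ l -> 3 * (#|H| * (3 * l + 1)) <= k ->
  ~ minor H G ->
  forall A : {set G}, A != set0 -> exists2 v, v \in A & #|A :&: nbh v| <= 2 * k.
Proof.
move=> k0 kl kH nHG A A0.
have cA : #|induced A| = #|A| by rewrite card_sig; apply: eq_card => x; rewrite inE.
apply/exists_inP; apply: contraT; rewrite negb_exists_in => /forall_inP h.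
case: nHG; apply: (@minor_induced _ A); apply: (minor_of_arcs k0 kl kH).
  by rewrite cA card_gt0.
rewrite card_arcs mulnC -cardsT -sum_nat_const (eq_bigl xpredT); last by move=> v; rewrite inE.
apply: leq_sum => v _; rewrite card_induced_nbh; apply: ltnW.
by rewrite ltnNge h // (valP v).
Qed.

(** * Disjoint unions of cocktail party graphs *)

Lemma cliqueP (G : sgraph) (K : {set G}) :
  reflect {in K &, forall u v, u != v -> adj u v} (is_clique K).
Proof.
apply: (iffP forall_inP) => [h u v uK vK uv|h u uK].
  by have /forall_inP/(_ v vK)/implyP/(_ uv) := h u uK.
by apply/forall_inP=> v vK; apply/implyP; apply: h.
Qed.

Section BlockGraph.
Variables (n b q : nat).
Hypothesis b0 : 0 < b.
Let m := q.+1 * b.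

(** Consecutive blocks of [m] vertices, each cut into classes of [b]: a full block is the complete
    multipartite graph with [q.+1] classes of size [b]. For [b = 1] it is a complete graph, for
    [b = 2] the complement of a perfect matching. The last block may be incomplete. *)
Definition block_adj : rel 'I_n := fun u v => (u %/ b != v %/ b) && (u %/ m == v %/ m).

Lemma block_sym : symmetric block_adj.
Proof. by move=> u v; rewrite /block_adj eq_sym [X in _ && X]eq_sym. Qed.

Lemma block_irrefl : irreflexive block_adj.
Proof. by move=> u; rewrite /block_adj eqxx. Qed.

Definition block_graph : sgraph := SGraph block_sym block_irrefl.

Let m0 : 0 < m. Proof. by rewrite muln_gt0. Qed.

Lemma card_block (c : nat) : #|[set v : 'I_n | v %/ m == c]| <= m.
Proof.
have fI : {in [set v : 'I_n | v %/ m == c] &, injective (fun v : 'I_n => Ordinal (ltn_pmod v m0))}.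
  move=> u v; rewrite !inE => /eqP uc /eqP vc /(congr1 val) /= E; apply: val_inj => /=.
  by rewrite (divn_eq u m) (divn_eq v m) uc vc E.
by rewrite -(card_in_imset fI) -[X in _ <= X]card_ord max_card.
Qed.

(* Codes a partial transversal of the [q.+1] classes of a block; the first class
   always contributes its first vertex. *)
Definition transversal_code (f : {ffun 'I_q -> option 'I_b}) (i : nat) : option nat :=
  if i is i'.+1 then obind (fun k : 'I_q => omap val (f k)) (insub i') else Some 0.

Definition transversal (p : 'I_(n %/ m) * {ffun 'I_q -> option 'I_b}) : {set block_graph} :=
  [set v : 'I_n | (v %/ m == p.1) && (transversal_code p.2 (v %% m %/ b) == Some (v %% b))].

Lemma transversal_clique p : is_clique (transversal p).
Proof.
apply/cliqueP=> u v; rewrite !inE => /andP[/eqP um /eqP ub] /andP[/eqP vm /eqP vb] uv.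
rewrite /= /block_adj um vm eqxx andbT; apply: contraNneq uv => E; apply/eqP/val_inj => /=.
rewrite (divn_eq u b) (divn_eq v b) E; congr (_ + _).
suff Ei : u %% m %/ b = v %% m %/ b by move: ub; rewrite Ei vb => -[].
have aux (w : nat) : w %% m %/ b = w %/ b - w %/ m * q.+1.
  by rewrite {2}(divn_eq w m) /m mulnA divnMDl // addKn.
by rewrite !aux E um vm.
Qed.

Lemma mem_transversal (p : 'I_(n %/ m) * {ffun 'I_q -> option 'I_b}) (v : 'I_n) i j :
  i < q.+1 -> j < b ->
  val v = p.1 * m + (i * b + j) ->
  (v \in transversal p) = (transversal_code p.2 i == Some j).
Proof.
move=> iq jb vE; have ijm : i * b + j < m.
  by rewrite /m mulSn addnC; apply: leq_trans (leq_add jb (_ : i * b <= q * b)) _;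
     rewrite // leq_mul2r -ltnS iq orbT.
rewrite inE -/(val v) vE divnMDl // (divn_small ijm) addn0 eqxx /= modnMDl (modn_small ijm).
by rewrite divnMDl // (divn_small jb) addn0 {1}/m mulnA addnA -mulnDl modnMDl (modn_small jb).
Qed.

Lemma transversal_lt (c : 'I_(n %/ m)) i j : i < q.+1 -> j < b -> c * m + (i * b + j) < n.
Proof.
move=> iq jb; have ijm : i * b + j < m.
  by rewrite /m mulSn addnC; apply: leq_trans (leq_add jb (_ : i * b <= q * b)) _;
     rewrite // leq_mul2r -ltnS iq orbT.
apply: leq_trans (_ : c.+1 * m <= n).
  by rewrite mulSn addnC ltn_add2r.
by rewrite -leq_divRL.
Qed.

Lemma transversal_inj : injective transversal.
Proof.
move=> [c f] [c' f'] E.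
have cc : c = c'.
  (* The first vertex of block [c] is always chosen, so the clique determines its block. *)
  pose v := Ordinal (transversal_lt c (ltn0Sn q) b0).
  have : v \in transversal (c, f) by rewrite (@mem_transversal _ v 0 0).
  rewrite E inE /= => /andP[/eqP + _]; rewrite divnMDl // div0n addn0.
  exact: val_inj.
move: E; rewrite -cc => E; congr (_, _); apply/ffunP=> k.
have key g : transversal_code g k.+1 = omap val (g k) by rewrite /= valK.
have aux g g' j : transversal (c, g) = transversal (c, g') -> g k = Some j -> g' k = Some j.
  move=> Eg gk; have kq : k.+1 < q.+1 by rewrite ltnS.
  pose v := Ordinal (transversal_lt c kq (ltn_ord j)).
  have : v \in transversal (c, g) by rewrite (@mem_transversal _ v k.+1 j) // key gk.
  rewrite Eg (@mem_transversal _ v k.+1 j) // key.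
  by case: (g' k) => //= j' /eqP[] /val_inj->.
case Ef: (f k) => [j|]; first by rewrite (aux _ _ _ E Ef).
by case Ef': (f' k) => [j|] //; rewrite (aux _ _ _ (esym E) Ef') in Ef.
Qed.

Lemma num_cliques_block : n %/ m * b.+1 ^ q <= num_cliques block_graph.
Proof.
have -> : n %/ m * b.+1 ^ q = #|{: 'I_(n %/ m) * {ffun 'I_q -> option 'I_b}}|.
  by rewrite card_prod card_ffun card_option !card_ord.
rewrite -(card_imset _ transversal_inj); apply/subset_leq_card/subsetP=> _ /imsetP[p _ ->].
by rewrite inE transversal_clique.
Qed.

End BlockGraph.

Lemma conn_block (G : sgraph) (blk : G -> nat) (S : {set G}) :
  (forall u v, adj u v -> blk u = blk v) -> conn S -> {in S &, forall u v, blk u = blk v}.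
Proof.
move=> hb [_ cS] u v uS vS.
have [E|n] := eqVneq [set w in S | blk w == blk u] S.
  by move: vS; rewrite -E inE => /andP[_ /eqP].
have [||x [y [xP yP xy]]] := cS [set w in S | blk w == blk u] _ _ n.
- by apply/subsetP=> w; rewrite inE => /andP[].
- by apply/set0Pn; exists u; rewrite inE uS eqxx.
move: xP yP; rewrite !inE => /andP[_ /eqP xu] /andP[+ yS].
by rewrite yS -xu (hb _ _ xy) eqxx.
Qed.

(** A connected branch set stays in one block and touching ones share it; as [H] is connected, the
    whole model lives in a single block. *)
Lemma model_block (H G : sgraph) (blk : G -> nat) (phi : H -> {set G}) :
  connected_graph H -> (forall u v, adj u v -> blk u = blk v) ->
  (forall h, conn (phi h)) -> (forall h h', adj h h' -> touch (phi h) (phi h')) ->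
  exists c, forall h, {in phi h, forall v, blk v = c}.
Proof.
move=> [/card_gt0P[h0 _] cH] hb cphi tphi.
have /set0Pn[v0 v0h] := (cphi h0).1; exists (blk v0) => h v vh.
pose P := [pred k | [forall w in phi k, blk w == blk v0]].
suff : h \in P by move/forall_inP/(_ v vh)/eqP.
have step : closed (@adj H) P.
  apply: intro_closed; first by apply: sym_connect_sym; apply: adj_sym.
  move=> k k' kk' /forall_inP kP; apply/forall_inP=> w wk'.
  have [x [y [xk yk' xy]]] := tphi k k' kk'.
  by rewrite (conn_block hb (cphi k') wk' yk') -(hb x y xy) kP.
rewrite -(closed_connect step (cH h0 h)); apply/forall_inP=> w wh0.
by rewrite (conn_block hb (cphi h0) wh0 v0h).
Qed.

(** The fibres with two elements are disjoint non-edges of [H], hence a matching in the complement;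
    each counts once more than the one element per fibre paid for by [#|J|]. *)
Lemma card_le_fibers_matching (H : sgraph) (S : {set H}) (J : finType) (g : H -> J) :
  {in S &, forall h h', h != h' -> g h = g h' -> ~~ adj h h'} ->
  (forall j, #|[set h in S | g h == j]| <= 2) ->
  #|S| <= #|J| + matching_number (compl_graph H).
Proof.
move=> nadj f2; pose F j := [set h in S | g h == j].
have -> : #|S| = \sum_j #|F j|.
  rewrite -sum1_card (partition_big g predT) //=; apply: eq_bigr => j _.
  by rewrite -sum1_card; apply: eq_bigl => h; rewrite inE.
pose J2 := [set j | #|F j| == 2].
have Fj j : #|F j| <= 1 + (j \in J2).
  by have := f2 j; rewrite -/(F j) inE; case: #|F j| => [|[|[|]]].
apply: leq_trans (_ : \sum_j (1 + (j \in J2)) <= _); first exact: leq_sum.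
rewrite big_split /= sum1_card leq_add2l -big_mkcond /= sum1_card.
have FI : {in J2 &, injective F}.
  move=> j j'; rewrite !inE => /eqP Fj2 _ E.
  have /card_gt0P[h hF] : 0 < #|F j| by rewrite Fj2.
  by move: (hF); rewrite E; move: hF; rewrite !inE => /andP[_ /eqP->] /andP[_ /eqP].
rewrite -(card_in_imset FI).
suff mM : @matching (compl_graph H) [set F j | j in J2].
  exact: (@leq_bigmax_cond _ (@matching (compl_graph H)) (fun M => #|M|) _ mM).
apply/andP; split.
  apply/subsetP=> _ /imsetP[j jJ ->].
  have /cards2P[u [v [uv E]]] : #|F j| == 2 by move: jJ; rewrite inE.
  have uF : u \in F j by rewrite E !inE eqxx.
  have vF : v \in F j by rewrite E !inE eqxx orbT.
  rewrite inE; apply/existsP; exists u; apply/existsP; exists v.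
  rewrite E eqxx andbT /= /compl_adj uv /=.
  move: uF vF; rewrite !inE => /andP[uS /eqP gu] /andP[vS /eqP gv].
  by apply: nadj; rewrite ?gu ?gv.
apply/trivIsetP=> _ _ /imsetP[j _ ->] /imsetP[j' _ ->] jj'.
rewrite disjoint_subset; apply/subsetP=> h; rewrite !inE => /andP[_ /eqP hj].
by apply/negP=> /andP[_ /eqP hj']; case/negP: jj'; rewrite -hj -hj'.
Qed.

Lemma card_sum_model (H : finType) (T : finType) (phi : H -> {set T}) (A : {set T}) :
  (forall h h', h != h' -> [disjoint phi h & phi h']) -> (forall h, phi h \subset A) ->
  \sum_h #|phi h| <= #|A|.
Proof.
move=> d s; apply: leq_trans (_ : #|\bigcup_h phi h| <= _).
  rewrite -sum1_card partition_disjoint_bigcup //; apply: leq_sum => h _.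
  by rewrite sum1_card.
by apply/subset_leq_card/bigcupsP.
Qed.

Lemma conn_card_gt0 (G : sgraph) (S : {set G}) : conn S -> 0 < #|S|.
Proof. by case=> S0 _; rewrite card_gt0. Qed.

Lemma block_no_minor1 (n q : nat) (H : sgraph) : connected_graph H -> q.+1 < #|H| ->
  ~ minor H (block_graph n 1 q).
Proof.
move=> cH tq /minor_model[phi [cphi dphi tphi]].
have [|c hc] := @model_block H _ (fun v : block_graph n 1 q => v %/ (q.+1 * 1)) phi cH _ cphi tphi.
  by move=> u v /andP[_ /eqP].
have := @card_sum_model _ _ phi [set v : 'I_n | v %/ (q.+1 * 1) == c] dphi _.
have s h : phi h \subset [set v : 'I_n | v %/ (q.+1 * 1) == c].
  by apply/subsetP=> v /hc vc; rewrite inE vc.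
move=> /(_ s); have := @card_block n 1 q isT c; rewrite muln1 => h1 h2.
have : \sum_(h : H) 1 <= q.+1.
  apply: leq_trans (leq_trans h2 h1); apply: leq_sum => h _; exact: conn_card_gt0.
by rewrite sum1_card leqNgt tq.
Qed.

(** Let [S] be the set of vertices of [H] with singleton branch sets. A block has [2 * q.+1]
    vertices, so [2 * #|H|] is at most [#|S| + 2 * q.+1]. Singletons in a common class are
    non-adjacent, so [#|S|] is at most [q.+1] plus the matching number. *)
Lemma block_no_minor2 (n q : nat) (H : sgraph) : connected_graph H ->
  3 * q.+1 + matching_number (compl_graph H) < 2 * #|H| ->
  ~ minor H (block_graph n 2 q).
Proof.
move=> cH tq /minor_model[phi [cphi dphi tphi]].
have [|c hc] := @model_block H _ (fun v : block_graph n 2 q => v %/ (q.+1 * 2)) phi cH _ cphi tphi.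
  by move=> u v /andP[_ /eqP].
have s h : phi h \subset [set v : 'I_n | v %/ (q.+1 * 2) == c].
  by apply/subsetP=> v /hc vc; rewrite inE vc.
have le := leq_trans (@card_sum_model _ _ phi _ dphi s) (@card_block n 2 q isT c).
pose S := [set h | #|phi h| == 1].
have SS : 2 * #|H| <= #|S| + q.+1 * 2.
  apply: leq_trans (leq_add (leqnn _) le).
  rewrite -sum1_card [X in _ <= X + _]big_mkcond /= -big_split /= mulnC -sum_nat_const.
  apply: leq_sum => h _; rewrite inE; have := conn_card_gt0 (cphi h).
  by case: #|phi h| => [|[|]].
have pick1 h : exists v, v \in phi h by have /set0Pn := (cphi h).1.
have /fin_all_exists[f fE] := pick1.
have fS h : h \in S -> phi h = [set f h].
  by rewrite inE => /cards1P[v E]; move: (fE h); rewrite E inE => /eqP->.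
have fI h h' : f h = f h' -> h = h'.
  move=> E; apply/eqP; apply: contraT => /dphi/disjointFr/(_ (fE h)).
  by rewrite E fE.
have lt v : v %% (q.+1 * 2) %/ 2 < q.+1 by rewrite ltn_divLR // ltn_pmod.
pose g h := Ordinal (lt (f h)).
have gE h h' : g h = g h' -> f h %/ 2 = f h' %/ 2.
  move/(congr1 val) => /= E.
  have aux (w : nat) : w %/ 2 = w %/ (q.+1 * 2) * q.+1 + w %% (q.+1 * 2) %/ 2.
    by rewrite {1}(divn_eq w (q.+1 * 2)) mulnA divnMDl.
  by rewrite aux [RHS]aux E !(hc _ _ (fE _)).
have := @card_le_fibers_matching H S _ g _ _; rewrite card_ord => key.
suff : #|S| <= q.+1 + matching_number (compl_graph H) by lia.
apply: key.
- move=> h h' hS h'S hh' /gE E; apply/negP=> /tphi[x [y]].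
  by rewrite !fS // !inE => -[/eqP-> /eqP->] /andP[]; rewrite E eqxx.
move=> j; pose r h := Ordinal (ltn_pmod (f h) (isT : 0 < 2)).
have rI : {in [set h in S | g h == j] &, injective r}.
  move=> h h'; rewrite !inE => /andP[_ /eqP ghj] /andP[_ /eqP gh'j] /(congr1 val) /= E.
  apply: fI; apply: val_inj => /=.
  by rewrite (divn_eq (f h) 2) (divn_eq (f h') 2) E (@gE h h') // ghj gh'j.
by rewrite -(card_in_imset rI) -[X in _ <= X]card_ord max_card.
Qed.

(** * Counting cliques *)

From mathcomp Require Import all_order all_algebra ring lra.
Import Order.TTheory GRing.Theory Num.Theory.

Definition cliques_in (G : sgraph) (A : {set G}) : nat :=
  #|[set K : {set G} | is_clique K & K \subset A]|.

Lemma sub_clique (G : sgraph) (K K' : {set G}) :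
  K' \subset K -> is_clique K -> is_clique K'.
Proof.
move=> /subsetP s /cliqueP cK; apply/cliqueP=> u v /s uK /s vK; exact: cK.
Qed.

Lemma cliques_in0 (G : sgraph) : cliques_in (set0 : {set G}) = 1.
Proof.
rewrite -(cards1 (set0 : {set G})); apply: eq_card => K; rewrite !inE subset0.
by case: eqP => [->|]; rewrite ?andbF // andbT; apply/cliqueP=> u v; rewrite inE.
Qed.

Lemma cliques_in_mono (G : sgraph) (A A' : {set G}) :
  A \subset A' -> cliques_in A <= cliques_in A'.
Proof.
move=> AA; apply/subset_leq_card/subsetP=> K; rewrite !inE => /andP[-> KA].
exact: subset_trans AA.
Qed.

Lemma cliques_in_rec (G : sgraph) (v : G) (A : {set G}) :
  cliques_in A <= cliques_in (A :\ v) + cliques_in (A :&: nbh v).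
Proof.
pose V := [set K : {set G} | v \in K].
rewrite {1}/cliques_in -(cardsID V) addnC; apply: leq_add.
  apply/subset_leq_card/subsetP=> K; rewrite !inE => /andP[vK /andP[-> KA]].
  by rewrite subsetD1 KA.
rewrite -(card_in_imset (f := fun K => K :\ v)); last first.
  move=> K K'; rewrite !inE => /andP[_ vK] /andP[_ vK'] E.
  by rewrite -(setD1K vK) E setD1K.
apply/subset_leq_card/subsetP=> _ /imsetP[K + ->]; rewrite !inE => /andP[/andP[cK KA] vK].
rewrite (sub_clique (subsetDl _ _) cK) subsetI (subset_trans (subsetDl _ _) KA) /=.
apply/subsetP=> z; rewrite !inE => /andP[zv zK].
by apply: (cliqueP _ cK); rewrite // eq_sym.
Qed.

(** The vertices of [X] are removed one at a time, each removal losing at most [m] cliques. *)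
Lemma cliques_in_setD (G : sgraph) (m : nat) (A X : {set G}) : X \subset A ->
  {in X, forall u, cliques_in (A :&: nbh u) <= m} ->
  cliques_in A <= cliques_in (A :\: X) + #|X| * m.
Proof.
have [n] := ubnP #|X|; elim: n => // n IHn in A X * => Xn XA hm.
have [->|/set0Pn[u uX]] := eqVneq X set0; first by rewrite setD0 leq_addr.
have cX := cardsD1 u X; rewrite uX in cX.
apply: leq_trans (cliques_in_rec u A) _.
have -> : A :\: X = (A :\ u) :\: (X :\ u).
  by apply/setP=> z; rewrite !inE; case: eqP => // ->; rewrite uX.
have := IHn (A :\ u) (X :\ u) _ (setSD _ XA) _; have := hm u uX.
rewrite cX mulSn => h1 h2; apply: leq_trans (leq_add (h2 _ _) h1) _.
- by move: Xn; rewrite cX.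
- move=> w; rewrite inE => /andP[_ wX]; apply: leq_trans (hm w wX).
  by apply: cliques_in_mono; rewrite setSI // subsetDl.
- by rewrite -addnA [X in _ + X]addnC.
Qed.

Lemma cocktail_add (G : sgraph) (v : G) (ps : seq (G * G)) qs :
  all (@adj G v) (unpair ps ++ qs) -> cocktail ps qs -> cocktail ps (v :: qs).
Proof.
elim: ps => [|p ps IH] /=; first by move=> -> ->.
case/and3P=> v1 v2 vs /and3P[-> /allP a c]; rewrite IH // andbT /=.
apply/allP=> z; rewrite mem_cat inE => zs.
have [zv|zv] := eqVneq z v; first by rewrite zv !(adj_sym _ v) v1 v2.
by apply: a; move: zs; rewrite (negPf zv) mem_cat.
Qed.

(** * Bounding cliques by symmetrisation *)

Section CocktailBound.
Local Open Scope ring_scope.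

Lemma sqr_succ_le_exp2 a : (3 <= a)%N -> (a.+1 ^ 2 <= 2 ^ a.+1)%N.
Proof.
elim: a => // a IH; rewrite leq_eqVlt => /orP[/eqP <- //|a3].
by have := IH a3; rewrite (expnS 2 a.+1) -!mulnn; nia.
Qed.

(** The bound is squared to avoid square roots. Induction on [#|A|] with [v] chosen to have the most
    cliques in its neighbourhood: each non-neighbour of [v] then contributes no more cliques than
    [v] does. *)
Lemma cliques_le_cocktail (R : realFieldType) (G : sgraph) (A : {set G}) :
  exists ps qs, [/\ cocktail ps qs, {subset unpair ps ++ qs <= A} &
    (cliques_in A)%:R ^+ 2 <= 2 ^+ (#|A| + size qs) * (9 / 4) ^+ size ps :> R].
Proof.
have [n] := ubnP #|A|; elim: n => // n IHn in A * => An.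
have [->|/set0Pn[v0 v0A]] := eqVneq A set0.
  exists [::], [::]; split=> //.
  by rewrite cliques_in0 cards0 addn0 !expr0 mulr1 expr1n.
have [v vA vmax] : exists2 v, v \in A &
    {in A, forall u, (cliques_in (A :&: nbh u) <= cliques_in (A :&: nbh v))%N}.
  have [v vA vm] := arg_maxnP (fun u => cliques_in (A :&: nbh u)) v0A.
  by exists v.
have small u : u \in A -> (#|A :&: nbh u| < n)%N.
  move=> uA; rewrite -ltnS; apply: leq_trans An; rewrite ltnS.
  apply/proper_card/properP; split; first exact: subsetIl.
  by exists u; rewrite // !inE adj_irrefl andbF.
have addv u ps qs : u \in A -> cocktail ps qs -> {subset unpair ps ++ qs <= A :&: nbh u} ->
    cocktail ps (u :: qs) /\ {subset unpair ps ++ u :: qs <= A}.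
  move=> uA c s; split.
    by apply: cocktail_add c; apply/allP=> z /s; rewrite !inE => /andP[].
  move=> z; rewrite mem_cat inE; have [->//|zu] := eqVneq z u.
  by move=> zs; have := s z; rewrite mem_cat zs inE => /(_ isT)/andP[].
pose a := #|A :\: nbh v|.
have mE : #|A| = (a + #|A :&: nbh v|)%N by rewrite addnC cardsID.
have a0 : (0 < a)%N by apply/card_gt0P; exists v; rewrite !inE adj_irrefl.
have [ps [qs [c s b]]] := IHn _ (small v vA).
(* Adding [v] to the single vertices pays for the factor [a + 1] if
   [(a + 1) ^ 2 <= 2 ^ (a + 1)], which only fails for [a = 2]. *)
have [a2|a2] := eqVneq a 2; last first.
  have [c' s'] := addv _ _ _ vA c s; exists ps, (v :: qs); split=> //=.
  have le : (cliques_in A <= a.+1 * cliques_in (A :&: nbh v))%N.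
    have := @cliques_in_setD G (cliques_in (A :&: nbh v)) A (A :\: nbh v) (subsetDl _ _).
    rewrite setDDr setDv set0U mulSn; apply=> u; rewrite inE => /andP[_]; exact: vmax.
  have a2' : (a.+1 ^ 2 <= 2 ^ a.+1)%N.
    move: a0 a2; case: (a) => [|[|[|a']]] // _ _; exact: sqr_succ_le_exp2.
  have -> : (#|A| + (size qs).+1 = a.+1 + (#|A :&: nbh v| + size qs))%N.
    by rewrite mE; move: #|A :&: _| (size _) => p q; clear; lia.
  rewrite exprD -mulrA.
  apply: le_trans (_ : (a.+1%:R * (cliques_in (A :&: nbh v))%:R) ^+ 2 <= _).
    by rewrite lerXn2r ?nnegrE ?mulr_ge0 // -natrM ler_nat.
  rewrite exprMn; apply: ler_pM; rewrite ?exprn_ge0 //.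
  by move: a2'; rewrite -(ler_nat R) !natrX.
have [w Ew] : exists w, (A :\: nbh v) :\ v = [set w].
  apply/cards1P; move: a2; rewrite /a (cardsD1 v) !inE adj_irrefl vA /=.
  by move=> /eqP; rewrite eqSS.
have : w \in (A :\: nbh v) :\ v by rewrite Ew inE.
rewrite !inE => /and3P[wv nvw wA].
have AvE : A :\ w :\ v = A :&: nbh v.
  apply/setP=> z; have := congr1 (fun B : {set G} => z \in B) Ew; rewrite !inE.
  have [->|zv] := eqVneq z v; first by rewrite adj_irrefl andbF.
  by have [->|zw] := eqVneq z w; rewrite ?(negPf nvw) ?andbF //=;
    case: (adj v z) => //=; rewrite ?andbT ?andbF // => ->.
have sub : A :&: nbh w \subset A :&: nbh v.
  rewrite -AvE; apply/subsetP=> z; rewrite !inE => /andP[-> wz]; rewrite andbT.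
  by apply/andP; split; apply: contraTneq wz => ->; rewrite ?adj_irrefl // adj_sym.
have cA : (cliques_in A <= 2 * cliques_in (A :&: nbh v) + cliques_in (A :&: nbh w))%N.
  have := cliques_in_rec w A; have := cliques_in_rec v (A :\ w); rewrite AvE.
  have : (cliques_in ((A :\ w) :&: nbh v) <= cliques_in (A :&: nbh v))%N.
    by apply: cliques_in_mono; rewrite setSI // subsetDl.
  do ![move: (cliques_in _) => ?]; clear; lia.
have addvw ps' qs' : cocktail ps' qs' -> {subset unpair ps' ++ qs' <= A :&: nbh w} ->
    cocktail ((v, w) :: ps') qs' /\ {subset unpair ((v, w) :: ps') ++ qs' <= A}.
  move=> c' s'; split=> /=.
    rewrite eq_sym wv c' andbT /=; apply/allP=> z /s' zw.
    by have := subsetP sub _ zw; move: zw; rewrite !inE => /andP[_ ->] /andP[_ ->].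
  move=> z; rewrite !inE => /or3P[/eqP->|/eqP->|/s'] //; by rewrite inE => /andP[].
(* If [v] and its other non-neighbour [w] are twins, the pair pays exactly for the factor 3, as
   [3 ^ 2 = 2 ^ 2 * (9 / 4)]. *)
have [E|nE] := eqVneq (A :&: nbh w) (A :&: nbh v).
  have [|c' s'] := addvw ps qs c; first by rewrite E.
  exists ((v, w) :: ps), qs; split=> //=.
  rewrite [(9 / 4) ^+ _]exprS mE a2.
  have -> : (2 + #|A :&: nbh v| + size qs = 2 + (#|A :&: nbh v| + size qs))%N by rewrite addnA.
  rewrite exprD.
  have le : (cliques_in A)%:R <= 3 * (cliques_in (A :&: nbh v))%:R :> R.
    rewrite -natrM ler_nat; move: cA; rewrite E.
    by move: (cliques_in _) (cliques_in _) => p q; clear; lia.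
  have le0 : 0 <= (cliques_in A)%:R :> R by rewrite ler0n.
  have le2 : (cliques_in A)%:R ^+ 2 <= (3 * (cliques_in (A :&: nbh v))%:R) ^+ 2 :> R.
    by rewrite lerXn2r ?nnegrE ?mulr_ge0.
  apply: le_trans le2 _; set X := 2 ^+ (_ + _) in b *; set Y := (9 / 4) ^+ _ in b *.
  have -> : 2 ^+ 2 * X * (9 / 4 * Y) = 9 * (X * Y) by field.
  by move: b; rewrite exprMn; move: (_%:R ^+ 2) (X * Y) => u Z; clear; lra.
have lt : (#|A :&: nbh w| < #|A :&: nbh v|)%N.
  by apply: proper_card; rewrite properEneq nE.
have [ps' [qs' [c' s' b']]] := IHn _ (small w wA).
have [c1 s1] := addv _ _ _ vA c s; have [c2 s2] := addvw _ _ c' s'.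
(* Two candidates: [v] as a single vertex on top of the structure in its neighbourhood, or the pair
   [(v, w)] on top of the one in the neighbourhood of [w]. The larger of the two bounds suffices. *)
pose F1 : R := 2 ^+ (#|A| + (size qs).+1) * (9 / 4) ^+ size ps.
pose F2 : R := 2 ^+ (#|A| + size qs') * (9 / 4) ^+ (size ps').+1.
pose x : R := (cliques_in (A :&: nbh v))%:R.
pose y : R := (cliques_in (A :&: nbh w))%:R.
have F1x : 8 * x ^+ 2 <= F1.
  rewrite /F1 (_ : (#|A| + (size qs).+1 = 3 + (#|A :&: nbh v| + size qs))%N); last first.
    by rewrite mE a2; move: #|A :&: _| (size _) => p q; clear; lia.
  rewrite exprD -mulrA; move: b; rewrite -/x; move: (x ^+ 2) (_ * _) => u Z; clear; lra.
have F2y : 18 * y ^+ 2 <= F2.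
  have le : 2 ^+ (3 + (#|A :&: nbh w| + size qs')) <= 2 ^+ (#|A| + size qs') :> R.
    apply: ler_weXn2l; [by lra | move: lt; rewrite mE a2].
    move: #|_| #|_| (size _) => p q z; clear; lia.
  rewrite exprD in le; rewrite /F2 [(9 / 4) ^+ _]exprS.
  have q0 : 0 <= (9 / 4) ^+ size ps' :> R by apply: exprn_ge0; lra.
  move: b' le q0; rewrite -/y.
  move: (2 ^+ _) (2 ^+ (#|A| + _)) ((9 / 4) ^+ _) (y ^+ 2) => P P' Q z; clear => b' le q0.
  by have := ler_wpM2r q0 le; lra.
have cA' : (cliques_in A)%:R <= 2 * x + y.
  by rewrite /x /y -natrM -natrD ler_nat.
have cA0 : 0 <= (cliques_in A)%:R :> R by rewrite ler0n.
have sq : (cliques_in A)%:R ^+ 2 <= (2 * x + y) ^+ 2 :> R.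
  by rewrite lerXn2r ?nnegrE // (le_trans cA0).
(* This bounds [4xy] by [2x^2/3 + 6y^2], so [(2x + y)^2] is at most [14x^2/3 + 7y^2], and thus at
   most [7/12 + 7/18 = 35/36] of the maximum of [F1] and [F2]. *)
have xy : 0 <= (x - 3 * y) ^+ 2 by apply: sqr_ge0.
have [F12|F12] := leP F1 F2.
  exists ((v, w) :: ps'), qs'; split=> //.
  rewrite -/F2; apply: le_trans sq _; clearbody F1 F2 x y; clear -F1x F2y xy F12; nra.
exists ps, (v :: qs); split=> //.
rewrite -/F1; apply: le_trans sq _; clearbody F1 F2 x y; clear -F1x F2y xy F12; nra.
Qed.

End CocktailBound.

Lemma cliques_le_cocktail_nat (G : sgraph) (A : {set G}) :
  exists ps qs, [/\ cocktail ps qs, {subset unpair ps ++ qs <= A} &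
    cliques_in A ^ 2 * 4 ^ size ps <= 2 ^ (#|A| + size qs) * 9 ^ size ps].
Proof.
have [ps [qs [c s b]]] := cliques_le_cocktail rat A.
exists ps, qs; split=> //; rewrite -(ler_nat rat) !natrM !natrX.
have q0 : (0 < 4 ^+ size ps :> rat)%R by rewrite exprn_gt0.
by rewrite -ler_pdivlMr // -mulrA -expr_div_n.
Qed.

(** * From sets with small non-degrees to all graphs without the minor *)

Lemma leq_expn2r m n e : m <= n -> m ^ e <= n ^ e.
Proof. by case: e => // e; rewrite leq_exp2r. Qed.

(** If at most [x] pairs occur, all of them can be used in the minor, and [9 / 4] is estimated by 4.
    Otherwise only [x] pairs are kept, and one end of each other pair. *)
Lemma dense_cliques (H G : sgraph) (D : nat) (A : {set G}) :
  {in A, forall v, #|A :\: nbh v| <= D} -> ~ model H G ->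
  let t := #|H| in let x := matching_number (compl_graph H) in
  cliques_in A ^ 2 <= 2 ^ (t.*2 + D * D) \/
  cliques_in A ^ 3 * 3 ^ x <= 3 ^ (t.*2 + D * D).
Proof.
move=> dA nHG t x; have [ps [qs [c s b]]] := cliques_le_cocktail_nat A.
have [rx|xr] := leqP (size ps) x; [left|right].
  have := cocktail_minor_bound dA c s rx nHG; rewrite size_cat size_unpair => le.
  rewrite -(leq_pmul2r (_ : 0 < 4 ^ size ps)) ?expn_gt0 //; apply: leq_trans b _.
  apply: leq_trans (_ : 2 ^ (#|A| + size qs) * (2 ^ (size ps).*2 * 4 ^ size ps) <= _).
    by rewrite leq_mul2l -mul2n expnM -expnMn leq_expn2r ?orbT.
  rewrite mulnA leq_mul2r -expnD leq_exp2l // orbC; apply/orP; left.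
  by move: le; rewrite -/t; clear; lia.
have c' : cocktail (take x ps) ([seq p.1 | p <- drop x ps] ++ qs).
  by apply: cocktail_drop; rewrite cat_take_drop.
have s' : {subset unpair (take x ps) ++ [seq p.1 | p <- drop x ps] ++ qs <= A}.
  move=> z; rewrite !mem_cat => zs; apply: s; rewrite mem_cat.
  rewrite -{1}(cat_take_drop x ps) unpair_cat mem_cat.
  case/or3P: zs => [->//|zs|->]; last by rewrite !orbT.
  apply/orP; left; apply/orP; right; apply/flattenP; case/mapP: zs => p pd ->.
  by exists [:: p.1; p.2]; rewrite ?inE ?eqxx //; apply: map_f.
have sx : size (take x ps) = x by rewrite size_takel // ltnW.
have := @cocktail_minor_bound H G D A _ _ dA c' s' _ nHG.
rewrite sx !size_cat size_unpair sx size_map size_drop => /(_ (leqnn _)) le.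
have mA : (size ps).*2 + size qs <= #|A|.
  rewrite -size_unpair -size_cat -(card_uniqP (cocktail_uniq c)).
  by apply/subset_leq_card/subsetP.
(* The slack in the exponent: the square of the clique number is at most [2 ^ e * 9 ^ size ps], and
   [8 <= 9] turns the cube of [2 ^ e] into [9 ^ e]. *)
pose e := t.*2 + D * D - x - 3 * size ps.
have eE : t.*2 + D * D = x + 3 * size ps + e by rewrite /e; lia.
have qE : #|A| + size qs <= e + 2 * size ps by lia.
have b2 : cliques_in A ^ 2 <= 2 ^ e * 9 ^ size ps.
  rewrite -(leq_pmul2r (_ : 0 < 4 ^ size ps)) ?expn_gt0 //; apply: leq_trans b _.
  rewrite mulnAC leq_mul2r (_ : 4 ^ _ = 2 ^ (2 * size ps)) -?expnD ?expnM //.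
  by rewrite leq_exp2l // qE orbT.
rewrite eE -addnA expnD mulnC leq_mul2l; apply/orP; right.
rewrite -(leq_exp2r _ _ (_ : 0 < 2)) // -expnM mulnC expnM.
apply: leq_trans (_ : (2 ^ e * 9 ^ size ps) ^ 3 <= _); first by rewrite leq_exp2r.
rewrite expnMn -!expnM [e * 3]mulnC [2 ^ _]expnM -[9]/(3 ^ 2).
apply: leq_trans (_ : (3 ^ 2) ^ e * (3 ^ 2) ^ (size ps * 3) <= _).
  by rewrite leq_mul2r leq_expn2r ?orbT.
by rewrite -expnD -expnM leq_exp2l //; clear; lia.
Qed.

(** Branch on a vertex with more than [D] non-neighbours. Taking it loses more than [D] vertices,
    which can happen at most [i] times; between two such choices at most [N] vertices are discarded,
    hence a factor [N.+1] each. *)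
Lemma peeling (G : sgraph) (N D B : nat) : 0 < B ->
  (forall A : {set G}, {in A, forall v, #|A :\: nbh v| <= D} -> cliques_in A <= B) ->
  forall i (A : {set G}), #|A| <= N -> #|A| <= i * D ->
  cliques_in A <= B * N.+1 ^ i.
Proof.
move=> B0 dB; elim=> [|i IHi] A AN.
  by rewrite mul0n leqn0 cards_eq0 => /eqP ->; rewrite cliques_in0 expn0 muln1.
move=> Ai; suff : cliques_in A <= B * N.+1 ^ i * #|A|.+1.
  by move=> h; apply: leq_trans h _; rewrite expnSr mulnA leq_mul2l ltnS AN orbT.
have p0 : 0 < N.+1 ^ i by rewrite expn_gt0.
have [n] := ubnP #|A|; elim: n => // n IHn in A AN Ai *; rewrite ltnS => An.
have [d|] := boolP [forall v in A, #|A :\: nbh v| <= D].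
  apply: leq_trans (dB A (forall_inP d)) _.
  by rewrite -mulnA leq_pmulr // muln_gt0 p0.
rewrite negb_forall => /existsP[v]; rewrite negb_imply -ltnNge => /andP[vA Dv].
have Ac := cardsD1 v A; rewrite vA in Ac.
have Avn := cardsID (nbh v) A.
apply: leq_trans (cliques_in_rec v A) _; rewrite mulnS addnC.
apply: leq_add; first by apply: IHi; [lia | rewrite mulSn in Ai; lia].
by rewrite Ac; apply: IHn; lia.
Qed.

(** Removing a vertex with at most [N] neighbours loses at most [C] cliques; the final 1 is the
    empty clique. *)
Lemma degenerate_cliques (G : sgraph) (N C : nat) :
  (forall A : {set G}, A != set0 -> exists2 v, v \in A & #|A :&: nbh v| <= N) ->
  (forall A : {set G}, #|A| <= N -> cliques_in A <= C) ->
  forall A : {set G}, cliques_in A <= #|A| * C + 1.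
Proof.
move=> deg cC A; have [n] := ubnP #|A|; elim: n => // n IHn in A *.
have [->|A0] := eqVneq A set0; first by rewrite cards0 cliques_in0.
have [v vA vN] := deg A A0; have := cardsD1 v A; rewrite vA => Ac.
rewrite ltnS => An; apply: leq_trans (cliques_in_rec v A) _.
rewrite Ac mulnDl mul1n -addnA addnC leq_add ?cC // IHn //; lia.
Qed.

Lemma num_cliques_bound (H G : sgraph) (k l D : nat) :
  0 < k -> 2 * k * 2 ^ l < 3 ^ l -> 3 * (#|H| * (3 * l + 1)) <= k -> 0 < D ->
  0 < #|G| -> ~ minor H G ->
  let t := #|H| in let x := matching_number (compl_graph H) in
  exists2 b, b ^ 2 <= 2 ^ (t.*2 + D * D) \/ b ^ 3 * 3 ^ x <= 3 ^ (t.*2 + D * D)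
    & num_cliques G <= 2 * (2 * k).+1 ^ (2 * k %/ D).+1 * b * #|G|.
Proof.
move=> k0 kl kH D0 G0 nHG t x.
have nm : ~ model H G by move=> /model_minor.
pose dense := [pred A : {set G} | [forall v in A, #|A :\: nbh v| <= D]].
have dense0 : 0 < #|dense|.
  by apply/card_gt0P; exists set0; apply/forall_inP=> v; rewrite inE.
(* A maximiser among the dense sets makes one alternative of [dense_cliques] serve for all of
   them. *)
have [A0 /forall_inP dA0 EA0] := eq_bigmax_cond (@cliques_in G) dense0.
exists (cliques_in A0); first exact: dense_cliques.
have dB (A : {set G}) : {in A, forall v, #|A :\: nbh v| <= D} -> cliques_in A <= cliques_in A0.
  move=> dA; have := @leq_bigmax_cond _ (fun A => A \in dense) (@cliques_in G) A.
  by rewrite EA0; apply; apply/forall_inP.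
have B0 : 0 < cliques_in A0.
  by apply: leq_trans (dB set0 _); rewrite ?cliques_in0 // => v; rewrite inE.
have small (A : {set G}) : #|A| <= 2 * k ->
    cliques_in A <= cliques_in A0 * (2 * k).+1 ^ (2 * k %/ D).+1.
  move=> Ak; apply: (peeling B0 dB) => //; apply: leq_trans Ak _.
  by apply: ltnW; rewrite ltn_ceil.
have -> : num_cliques G = cliques_in [set: G].
  by apply: eq_card => K; rewrite !inE subsetT andbT.
apply: leq_trans (degenerate_cliques (degenerate_of_no_minor k0 kl kH nHG) small _) _.
have P0 : 0 < (2 * k).+1 ^ (2 * k %/ D).+1 by rewrite expn_gt0.
rewrite cardsT; move: #|G| (cliques_in A0) (_ ^ _) G0 B0 P0 => n b P; clear => n0 b0 P0.
have : 0 < n * (b * P) by rewrite !muln_gt0 n0 b0.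
by lia.
Qed.

(** * The error term and its growth *)

(* [lg t ^ 3] is the bound on the non-degrees at which the branching stops; in
   [err], the term [lg t ^ 6] is its square (the vertices left over when pairing
   up), [peel_exp t] is the cost of the branching, and the remaining terms absorb
   factors linear in [t]. *)
Definition lg (t : nat) := (trunc_log 2 t).+1.
(** The value of [k] in [minor_of_arcs] for [l = 32 * lg t]; the degeneracy is at most twice
    this. *)
Definition deg_half (t : nat) := 3 * (t * (3 * (32 * lg t) + 1)).
Definition peel_exp (t : nat) := 16 * lg t * (2 * deg_half t %/ lg t ^ 3).+1.
Definition err (t : nat) := lg t ^ 6 + peel_exp t + lg t + 9.

Lemma lt_exp_lg t : t < 2 ^ lg t.
Proof. by case: t => // t; exact: trunc_log_ltn. Qed.

Lemma deg_half_lt t : (2 * deg_half t).+1 <= 2 ^ (16 * lg t).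
Proof.
rewrite /deg_half; have := lt_exp_lg t; have : lg t < 2 ^ lg t by exact: ltn_expl.
have : 0 < lg t by []; move: (lg t) => L L0 h1 h2.
(* The two summands [L] pay for [t.+1] and [L.+1], and [10 * L] pays for the constant, rounded up to
   1024. *)
have -> : 16 * L = L + L + 10 * L + 4 * L by lia.
rewrite expnD; apply: leq_trans (leq_pmulr _ (_ : 0 < 2 ^ (4 * L))); last by rewrite expn_gt0.
have h3 : 1024 <= 2 ^ (10 * L) by rewrite -[1024]/(2 ^ 10) leq_exp2l //; clear -L0; lia.
rewrite expnD; move: (2 ^ (10 * L)) h3 => c h3; rewrite expnD.
move: (2 ^ L) h1 h2 => a h1 h2.
apply: leq_trans (_ : a * a * 1024 <= _); last by rewrite leq_mul2l h3 orbT.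
have : t.+1 * L.+1 <= a * a by rewrite leq_mul.
move: (a * a) => q; clear -L0; nia.
Qed.

(** The left side is below [2 ^ (48 * lg t) = 8 ^ (16 * lg t)], the right side is
    [9 ^ (16 * lg t)]. *)
Lemma deg_half_exp t : 2 * deg_half t * 2 ^ (32 * lg t) < 3 ^ (32 * lg t).
Proof.
apply: leq_trans (_ : 2 ^ (16 * lg t) * 2 ^ (32 * lg t) <= _).
  by rewrite ltn_mul2r expn_gt0 deg_half_lt.
rewrite -expnD -mulnDl -[16 + 32]/(3 * 16) -[32]/(2 * 16) -!mulnA (expnM 2) (expnM 3).
by rewrite leq_exp2r // muln_gt0.
Qed.

Lemma poly_le_exp m : exists L0, forall L, L0 <= L -> m * L ^ 6 <= 2 ^ L.
Proof.
exists (16 * (m + 5)) => L mL; set q := L %/ 16.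
have Lq : L <= 16 * q.+1 by rewrite mulnC ltnW // ltn_ceil.
have qL : 16 * q <= L by rewrite mulnC leq_trunc_div.
have mq : m + 5 <= q by rewrite leq_divRL // mulnC.
apply: leq_trans (_ : m * (16 * 2 ^ q) ^ 6 <= _).
  by rewrite leq_mul // leq_exp2r // (leq_trans Lq) // leq_mul2l ltn_expl.
apply: leq_trans (_ : 2 ^ m * (2 ^ (4 + q)) ^ 6 <= _).
  by rewrite (expnD 2 4) leq_mul // ltnW // ltn_expl.
rewrite -expnM -expnD leq_exp2l //; lia.
Qed.

(** The integer form of [err t = o(t)]. With [L = lg t], the branching cost is of order [t / L + L];
    the remaining terms are polynomial in [L], hence small against [2 ^ L <= 2 * t]. *)
Lemma err_small m : exists t0, forall t, t0 <= t -> m * err t <= t.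
Proof.
have [L0 hL0] := poly_le_exp (4 * m * 50).
exists (2 ^ (L0 + 2 * (16 * 600) * m)) => t tL.
have LL : L0 + 2 * (16 * 600) * m < lg t.
  by rewrite ltnS trunc_log_max.
have t0 : 0 < t by apply: leq_trans tL; rewrite expn_gt0.
have Lt : 2 ^ lg t <= 2 * t by rewrite expnS leq_mul2l trunc_logP.
have := hL0 (lg t) (ltnW (leq_ltn_trans (leq_addr _ _) LL)).
have Lm : 2 * (16 * 600) * m <= lg t by apply: ltnW; apply: leq_ltn_trans LL; rewrite leq_addl.
have L1 : 0 < lg t by [].
rewrite /err /peel_exp /deg_half; move: (lg t) L1 Lm Lt {LL hL0 tL} => L L1 Lm Lt h.
set Q := _ %/ _.
have hQ : 16 * L * Q * L <= 16 * 582 * t.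
  have := leq_trunc_div (2 * (3 * (t * (3 * (32 * L) + 1)))) (L ^ 3); rewrite -/Q => hQ.
  have : Q * L * L <= 582 * t.
    rewrite -(leq_pmul2r L1) -!mulnA -[L * (L * L)]/(L ^ 3).
    by apply: leq_trans hQ _; nia.
  by nia.
have L6 : L <= L ^ 6 by rewrite -{1}(expn1 L) leq_pexp2l.
have : 2 * (m * (16 * L * Q)) <= t.
  rewrite -(leq_pmul2r L1); nia.
move: (L ^ 6) L6 h => P L6 h; rewrite mulnS; nia.
Qed.

Lemma peel_exp_ge t :
  2 * (2 * deg_half t).+1 ^ (2 * deg_half t %/ lg t ^ 3).+1 <= 2 ^ (peel_exp t).+1.
Proof.
rewrite [2 ^ _.+1]expnS leq_mul2l /=; apply: leq_trans (leq_expn2r _ (deg_half_lt t)) _.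
by rewrite -expnM.
Qed.

Lemma exp_err_ge t : 64 * t <= 2 ^ err t.
Proof.
apply: leq_trans (_ : 2 ^ (lg t + 6) <= _).
  by rewrite expnD mulnC leq_mul // ltnW // lt_exp_lg.
by rewrite leq_exp2l // /err; move: (lg t ^ 6) (peel_exp t) => a c; lia.
Qed.

(** * Graphs with many cliques *)

Lemma matching_number_le (H : sgraph) : 2 * matching_number (compl_graph H) <= #|H|.
Proof.
have [ps [<- u _]] := matching_pairs (leqnn (matching_number (compl_graph H))).
by rewrite mul2n -size_unpair -(card_uniqP u) max_card.
Qed.

Lemma many_cliques_exp2 (H : sgraph) (n : nat) :
  connected_graph H -> 2 <= #|H| -> #|H| <= n ->
  exists G : sgraph, [/\ #|G| = n, ~ minor H G &
    2 ^ #|H| * n <= 2 ^ err #|H| * num_cliques G].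
Proof.
(* The blocks are complete graphs on [#|H| - 1 = q.+1] vertices. *)
move=> cH t2 tn; pose q := #|H| - 2; have tE : #|H| = q.+2 by lia.
exists (block_graph n 1 q); split; first exact: card_ord.
  by apply: block_no_minor1 => //; rewrite tE.
have := @num_cliques_block n 1 q isT; rewrite muln1 => le.
set Q := n %/ q.+1 in le.
have nQ : n < Q.+1 * q.+1 by rewrite ltn_ceil.
have Q1 : 0 < Q by rewrite divn_gt0 //; lia.
apply: leq_trans (leq_mul (exp_err_ge #|H|) le); rewrite tE !expnS.
move: (2 ^ q) => P; clearbody Q; rewrite tE in tn.
have n2 : n <= 2 * (Q * q.+1) by nia.
apply: leq_trans (_ : 2 * (2 * P) * (2 * (Q * q.+1)) <= _); first by rewrite leq_mul2l n2 orbT.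
by clear; nia.
Qed.

Lemma many_cliques_exp3 (H : sgraph) (n : nat) :
  connected_graph H -> 4 <= #|H| ->
  let x := matching_number (compl_graph H) in
  4 * #|H| <= 3 * n + 2 * x ->
  exists (G : sgraph) (s : nat), [/\ #|G| = n, ~ minor H G, 2 * #|H| <= 3 * s + x &
    3 ^ s * n <= 2 ^ err #|H| * num_cliques G].
Proof.
move=> cH t4 x xn; have x2 : 2 * x <= #|H| := matching_number_le H.
(* The largest number of classes of size two with [3 * r + x < 2 * #|H|], as [block_no_minor2]
   demands. A block has [2 * r] vertices, and the bound on [n] gives room for at least one block. *)
pose r := (2 * #|H| - x - 1) %/ 3.
have r1 : 3 * r <= 2 * #|H| - x - 1 by rewrite mulnC leq_trunc_div.
have r2 : 2 * #|H| - x - 1 < 3 * r.+1 by rewrite [3 * _]mulnC ltn_ceil.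
have [q qE] : exists q, r = q.+1 by exists r.-1; rewrite prednK //; lia.
rewrite qE in r1 r2.
exists (block_graph n 2 q), q.+2; split; first exact: card_ord.
- by apply: block_no_minor2 => //; rewrite -/x; lia.
- by lia.
have := @num_cliques_block n 2 q isT; set Q := n %/ _ => le.
have nQ : n < Q.+1 * (q.+1 * 2) by rewrite ltn_ceil.
have Q1 : 0 < Q by rewrite divn_gt0 //; lia.
have qt : q.+1 <= #|H| by lia.
apply: leq_trans (leq_mul (exp_err_ge #|H|) le); rewrite !expnS.
move: (3 ^ q) => P; clearbody Q; move: #|H| qt => t qt.
have n2 : n <= 4 * (Q * q.+1) by clear -nQ Q1; nia.
apply: leq_trans (_ : 3 * (3 * P) * (4 * (Q * q.+1)) <= _); first by rewrite leq_mul2l n2 orbT.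
apply: leq_trans (_ : 3 * (3 * P) * (4 * (Q * t)) <= _); first by rewrite !leq_mul2l qt !orbT.
by clear; nia.
Qed.

(* Real exponents and the theorem *)
From mathcomp Require Import all_classical all_reals all_analysis.
Import numFieldNormedType.Exports.
Local Open Scope classical_set_scope.
Local Open Scope ring_scope.

Lemma err_cvg0 (R : realType) : (fun t : nat => (err t)%:R / t%:R) @ \oo --> (0 : R).
Proof.
apply/cvgrPdist_le => e e0; pose m := (Num.truncn e^-1).+1.
have [t0 ht0] := err_small m.
near=> t; have t0t : (t0 < t)%N by near: t; exact: nbhs_infty_gt.
have tp : 0 < t%:R :> R by rewrite ltr0n (leq_ltn_trans _ t0t).
rewrite sub0r normrN ger0_norm ?divr_ge0 // ler_pdivrMr //.
have me : e^-1 <= m%:R by rewrite ltW // truncnS_gt.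
have := ht0 t (ltnW t0t); rewrite -(ler_nat R) natrM => le.
rewrite -ler_pdivrMl // mulrC; apply: le_trans le; rewrite mulrC ler_wpM2r //.
Unshelve. all: by end_near.
Qed.

Lemma le_powR_root (R : realType) (a b y : R) (k : nat) :
  (0 < k)%N -> 0 <= b -> b ^+ k <= a `^ y -> b <= a `^ (y / k%:R).
Proof.
move=> k0 b0 h; rewrite -(ler_pXn2r k0) ?nnegrE ?powR_ge0 //.
by rewrite -[(a `^ _) ^+ k]powR_mulrn ?powR_ge0 // -powRrM divfK // pnatr_eq0 -lt0n.
Qed.

Theorem theorem1p2 (R : realType) :
  exists g : nat -> R,
    [/\ (forall t : nat, (1 <= t)%N -> 0 <= g t),
        (fun t : nat => g t / t%:R) @ \oo --> (0 : R),
        (forall (t : nat) (H : sgraph),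
           (1 <= t)%N -> #|H| = t -> connected_graph H ->
           let x := matching_number (compl_graph H) in
           forall (n : nat) (G : sgraph),
             (1 <= n)%N -> #|G| = n -> ~ minor H G ->
             (num_cliques G)%:R <=
               Num.max
                 (3 `^ (2 * t%:R / 3 - x%:R / 3 + g t) * n%:R)
                 (2 `^ (t%:R + g t) * n%:R))
      & (exists t0 : nat, forall (t : nat) (H : sgraph),
           (t0 <= t)%N -> #|H| = t -> connected_graph H ->
           let x := matching_number (compl_graph H) in
           forall n : nat,
             Num.max (4 * t%:R / 3 - 2 * x%:R / 3) t%:R <= n%:R :> R ->
             exists G : sgraph,
               [/\ #|G| = n, ~ minor H G
                 & Num.max
                     (3 `^ (2 * t%:R / 3 - x%:R / 3 - g t) * n%:R)
                     (2 `^ (t%:R - g t) * n%:R)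
                   <= (num_cliques G)%:R])].
Proof.
have p3 : 0 < 3 :> R by lra.
have p2 : 0 < 2 :> R by lra.
exists (fun t => (err t)%:R); split.
- by move=> t _; apply: ler0n.
- exact: err_cvg0.
- move=> t H t1 Ht cH x n G n1 Gn nHG.
  have k0 : (0 < deg_half #|H|)%N by rewrite /deg_half Ht; move: t1 (lg t); clear; nia.
  have D0 : (0 < lg #|H| ^ 3)%N by rewrite expn_gt0.
  have G0 : (0 < #|G|)%N by rewrite Gn.
  have [b bB le] := num_cliques_bound k0 (deg_half_exp _) (leqnn _) D0 G0 nHG.
  rewrite /= -/x Ht Gn in bB le.
  have := leq_mul (leq_mul (peel_exp_ge t) (leqnn b)) (leqnn n) => /(leq_trans le) {}le.
  rewrite (_ : (lg t ^ 3 * lg t ^ 3 = lg t ^ 6)%N) in bB; last by rewrite -expnD.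
  move: bB le; rewrite /err; move: (lg t ^ 6)%N => W; move: (lg t) (peel_exp t) => L c bB le.
  have leR : (num_cliques G)%:R <= 2 `^ c.+1%:R * b%:R * n%:R :> R.
    by rewrite powR_mulrn ?(ltW p2) ?(ltW p3) // -natrX -!natrM ler_nat.
  apply: le_trans leR _; rewrite le_max; apply/orP.
  (* Each alternative for [b] gives one term of the maximum, after taking a square or cube root. *)
  case: bB => bB; [right|left]; apply: ler_wpM2r => //.
    have {}bB : b%:R <= 2 `^ ((t.*2 + W)%:R / 2%:R) :> R.
      by apply: le_powR_root => //; rewrite powR_mulrn ?(ltW p2) ?(ltW p3) // -!natrX ler_nat.
    apply: le_trans (ler_wpM2l (powR_ge0 _ _) bB) _.
    rewrite -powRD; last by rewrite (gt_eqF p2) implybT.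
    apply: ler_powR; first by lra.
    rewrite -[c.+1]addn1 -mul2n !natrD; have := ler0n R W; have := ler0n R L; lra.
  have {}bB : b%:R <= 3 `^ (((t.*2 + W)%:R - x%:R) / 3%:R) :> R.
    apply: le_powR_root => //; rewrite powRB ?(gt_eqF p2) ?(gt_eqF p3) ?implybT //.
    rewrite !powR_mulrn ?(ltW p2) ?(ltW p3) //.
    by rewrite ler_pdivlMr ?exprn_gt0 // -!natrX -natrM ler_nat.
  (* The branching cost is moved to base 3, so that the exponents add up. *)
  have c3 : 2 `^ c.+1%:R <= 3 `^ c.+1%:R :> R.
    by rewrite !powR_mulrn ?(ltW p2) ?(ltW p3) // lerXn2r ?nnegrE ?(ltW p2) ?(ltW p3) //; lra.
  apply: le_trans (ler_pM (powR_ge0 _ _) (ler0n _ _) c3 bB) _.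
  rewrite -powRD; last by rewrite (gt_eqF p3) implybT.
  apply: ler_powR; first by lra.
  rewrite -[c.+1]addn1 -mul2n !natrD; have := ler0n R W; have := ler0n R L; lra.
- exists 4 => t H t4 Ht cH x n; rewrite ge_max => /andP[n1 n2].
  set A := 3 `^ _ * _; set B := 2 `^ _ * _.
  have e2 : 0 < 2 ^+ err t :> R by rewrite exprn_gt0.
  rewrite ler_nat in n2.
  (* The larger term decides between complete blocks and complements of perfect matchings. *)
  have [AB|BA] := leP A B.
    have [||G [Gn nHG le]] := @many_cliques_exp2 H n cH; rewrite ?Ht ?(leq_trans _ t4) //.
    exists G; split=> //; rewrite /B powRB ?(gt_eqF p2) ?(gt_eqF p3) ?implybT //.
    rewrite !powR_mulrn ?(ltW p2) ?(ltW p3) // mulrAC ler_pdivrMr // mulrC [X in _ <= X]mulrC.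
    by move: le; rewrite Ht -(ler_nat R) !natrM !natrX mulrC.
  have [||G [s [Gn nHG st le]]] := @many_cliques_exp3 H n cH; rewrite ?Ht //.
    rewrite -/x -(ler_nat R) natrD !natrM; lra.
  exists G; split=> //; rewrite /A.
  have : 3 `^ (2 * t%:R / 3 - x%:R / 3 - (err t)%:R) <= 3 `^ (s%:R - (err t)%:R) :> R.
    apply: ler_powR; first by lra.
    by move: st; rewrite Ht -/x -(ler_nat R) natrD !natrM; lra.
  move/(ler_wpM2r (ler0n R n)) => h; apply: le_trans h _.
  rewrite powRB ?(gt_eqF p2) ?(gt_eqF p3) ?implybT //.
  rewrite !powR_mulrn ?(ltW p2) ?(ltW p3) // mulrAC ler_pdivrMr ?exprn_gt0 //.
  apply: le_trans (_ : (2 ^ err t * num_cliques G)%:R <= _).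
    by move: le; rewrite Ht -(ler_nat R) !natrM !natrX.
  by rewrite natrM natrX mulrC ler_wpM2l // lerXn2r ?nnegrE ?(ltW p2) ?(ltW p3) //; lra.
Qed.
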